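(* Let $H$ be a Hilbert space and let $X$ be a (right, full) Hilbert $C^*$-module over a $C^*$-algebra $A$ that is isometric, as a Banach space, to $H$. Then either $A$ is $*$-isomorphic to $\mathbb{C}$ and $X$ is completely isometrically isomorphic to $H^c$, or $A$ is $*$-isomorphic to $K(H)$ and $X$ is completely isometrically isomorphic to $H^r$.
   Context: ''Isometric'' means that there is a surjective linear isometry. A right Hilbert $C^*$-module $X$ over $A$ is full if $A=\overline{\mathrm{span}}\{\langle x,y\rangle:x,y\in X\}$. $K(H)$ is the algebra of compact operators on $H$. $H^c=B(\mathbb{C},H)$ is the Hilbert column space (the operators in $B(H)$ whose matrix in a fixed orthonormal basis is supported in the first column), a Hilbert $C^*$-module over $\mathbb{C}$. $H^r=B(H,\mathbb{C})$ is the Hilbert row space (operators whose matrix is supported in the first row), a Hilbert $C^*$-module over $K(H)$. $X$ carries the operator space structure inherited from its linking $C^*$-algebra $$\mathcal{L}(X)=\begin{pmatrix}\mathbb{K}(X)&X\\ \bar X&A\end{pmatrix},$$ where $\mathbb{K}(X)$ is the $C^*$-algebra generated by the operators $x\otimes y^*:z\mapsto x\langle y,z\rangle$ on $X$, $\bar X$ is the conjugate (left $A$-)module, multiplication is matrix multiplication with $x\cdot\bar y=x\otimes y^*$, $\bar y\cdot x=\langle y,x\rangle$, and the norm is the operator norm of the natural action on $X\oplus A$; $X$ is the upper right corner. *)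

(* Defs.v *)
From HB Require Import structures.
From mathcomp Require Import all_boot all_order all_algebra.
From mathcomp Require Import complex.
From mathcomp Require Import boolp classical_sets functions reals ereal.
From mathcomp Require Import topology normedtype.

Set Implicit Arguments.
Unset Strict Implicit.
Unset Printing Implicit Defensive.

Import Order.TTheory GRing.Theory Num.Theory.
Import numFieldNormedType.Exports.

Local Open Scope classical_set_scope.
Local Open Scope ring_scope.

(* The norm of a normed module over R[i] takes its (real) values in R[i];
   rnorm is the same number, seen in R. *)
Definition rnorm (R : realType) (V : normedModType R[i]) (v : V) : R :=
  complex.Re `|v|.

(* Inner products are linear in the first variable, as in sesquilinear.v. *)
HB.mixin Record CompleteNormedModule_isHilbert (R : realType) H
    of CompleteNormedModule R[i] H := {
  hdot : {dot H for Num.conj};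
  hdotE : forall x : H, hdot x x = `|x| ^+ 2
}.

#[short(type="hilbertType")]
HB.structure Definition Hilbert (R : realType) :=
  {H of CompleteNormedModule R[i] H & CompleteNormedModule_isHilbert R H}.

(* C*-algebras are not assumed to be unital, nor to be nonzero. *)
HB.mixin Record CompleteNormedModule_isCStarAlgebra (R : realType) A
    of CompleteNormedModule R[i] A := {
  cmul : A -> A -> A;
  cstar : A -> A;
  cmulA : associative cmul;
  cmulDl : left_distributive cmul +%R;
  cmulDr : right_distributive cmul +%R;
  cmulZl : forall (c : R[i]) (a b : A), cmul (c *: a) b = c *: cmul a b;
  cmulZr : forall (c : R[i]) (a b : A), cmul a (c *: b) = c *: cmul a b;
  cstarK : involutive cstar;
  cstarD : {morph cstar : a b / a + b};
  cstarZ : forall (c : R[i]) (a : A), cstar (c *: a) = Num.conj c *: cstar a;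
  cstarM : forall a b : A, cstar (cmul a b) = cmul (cstar b) (cstar a);
  cnormM : forall a b : A, `|cmul a b| <= `|a| * `|b|;
  cnorm_star : forall a : A, `|cmul (cstar a) a| = `|a| ^+ 2
}.

#[short(type="cstarAlgType")]
HB.structure Definition CStarAlgebra (R : realType) :=
  {A of CompleteNormedModule R[i] A & CompleteNormedModule_isCStarAlgebra R A}.

Definition cpositive (R : realType) (A : cstarAlgType R) (a : A) : Prop :=
  exists b : A, a = cmul (cstar b) b.

(* Definiteness of mip follows from mip_norm. *)
HB.mixin Record CompleteNormedModule_isHilbertModule (R : realType)
    (A : cstarAlgType R) X of CompleteNormedModule R[i] X := {
  mact : X -> A -> X;
  mip : X -> X -> A;
  mactDl : forall (x y : X) (a : A), mact (x + y) a = mact x a + mact y a;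
  mactDr : forall (x : X) (a b : A), mact x (a + b) = mact x a + mact x b;
  mactZl : forall (c : R[i]) (x : X) (a : A), mact (c *: x) a = c *: mact x a;
  mactZr : forall (c : R[i]) (x : X) (a : A), mact x (c *: a) = c *: mact x a;
  mactA : forall (x : X) (a b : A), mact x (cmul a b) = mact (mact x a) b;
  mipDr : forall x y z : X, mip x (y + z) = mip x y + mip x z;
  mipZr : forall (c : R[i]) (x y : X), mip x (c *: y) = c *: mip x y;
  mipMr : forall (x y : X) (a : A), mip x (mact y a) = cmul (mip x y) a;
  mip_star : forall x y : X, cstar (mip x y) = mip y x;
  mip_ge0 : forall x : X, cpositive (mip x x);
  mip_norm : forall x : X, `|mip x x| = `|x| ^+ 2
}.

#[short(type="hilbertModType")]
HB.structure Definition HilbertModule (R : realType) (A : cstarAlgType R) :=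
  {X of CompleteNormedModule R[i] X & CompleteNormedModule_isHilbertModule R A X}.

Arguments mact {R A s} x a.
Arguments mip {R A s} x y.

Definition linear_span (K : nzRingType) (V : lmodType K) (S : set V) : set V :=
  [set v | exists n (c : 'I_n -> K) (s : 'I_n -> V),
     (forall i, S (s i)) /\ v = \sum_(i < n) c i *: s i].

Definition full_module (R : realType) (A : cstarAlgType R)
    (X : hilbertModType A) : Prop :=
  closure (linear_span [set mip p.1 p.2 | p in [set: X * X]]) = [set: A].

Definition isometric (R : realType) (V W : normedModType R[i]) : Prop :=
  exists U : {linear V -> W},
    (forall v, `|U v| = `|v|) /\ (forall w, exists v, U v = w).

Section OperatorNorm.
Context {R : realType}.

Definition opnorm (E F : Type) (nE : E -> R) (nF : F -> R) (T : E -> F) :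
    \bar R :=
  ereal_sup [set (nF (T v))%:E | v in [set v | nE v <= 1]].

Definition mxop (E : Type) (F : nmodType) n (T : 'M[E -> F]_n)
    (v : 'I_n -> E) : 'I_n -> F :=
  fun i => \sum_(j < n) T i j (v j).

(* When E is a Hilbert space, this is the norm of E^n. *)
Definition l2norm (E : normedModType R[i]) n (v : 'I_n -> E) : R :=
  Num.sqrt (\sum_(i < n) rnorm (v i) ^+ 2).

Definition bounded_ops (E F : normedModType R[i]) : set (E -> F) :=
  [set T | linear T /\ continuous T].

(* The norm of M_n(B(E, F)) = B(E^n, F^n), for Hilbert spaces E and F. *)
Definition ops_mxnorm (E F : normedModType R[i]) n (T : 'M[E -> F]_n) :
    \bar R :=
  opnorm (@l2norm E n) (@l2norm F n) (mxop T).

End OperatorNorm.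

Arguments bounded_ops {R} E F.

Section LinkingAlgebra.
Context {R : realType} {A : cstarAlgType R} {X : hilbertModType A}.

Definition mod_adjoint (T S : X -> X) : Prop :=
  forall x y, mip (T x) y = mip x (S y).

Definition adjointable : set (X -> X) := [set T | exists S, mod_adjoint T S].

(* The C*-subalgebras of the algebra of adjointable operators on X; the last
   clause is closedness for the operator norm. *)
Definition cstar_subalgebra (S : set (X -> X)) : Prop :=
  [/\ S (fun=> 0),
      forall (c : R[i]) T U, S T -> S U -> S (fun x => c *: T x + U x),
      forall T U, S T -> S U -> S (T \o U),
      forall T, S T -> exists2 T', S T' & mod_adjoint T T'
    & forall T, adjointable T ->
        (forall e : R, 0 < e -> exists2 U, S U &
          (opnorm (@rnorm R X) (@rnorm R X) (fun x => T x - U x)%R <= e%:E)%E) ->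
        S T].

Definition rank_one (x y : X) : X -> X := fun z => mact x (mip y z).

Definition mod_compact : set (X -> X) :=
  smallest cstar_subalgebra [set rank_one p.1 p.2 | p in [set: X * X]].

Lemma mod_compact0 : mod_compact (fun=> 0).
Proof. by move=> S [[]]. Qed.

(* The matrix [ lk_ul lk_ur ; conj lk_ll lk_lr ]: an element of the conjugate
   module is represented by the corresponding element of X. *)
Record linking := Linking {
  lk_ul : X -> X;
  lk_ulP : mod_compact lk_ul;
  lk_ur : X;
  lk_ll : X;
  lk_lr : A
}.

(* The natural action on X (+) A; it is faithful, and the product of the
   linking algebra is the composition of these operators. *)
Definition lk_act (t : linking) (w : X * A) : X * A :=
  (lk_ul t w.1 + mact (lk_ur t) w.2, mip (lk_ll t) w.1 + cmul (lk_lr t) w.2).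

(* The norm of the Hilbert module (X (+) A)^n over A. *)
Definition xa_norm n (w : 'I_n -> X * A) : R :=
  Num.sqrt (rnorm
    (\sum_(i < n) (mip (w i).1 (w i).1 + cmul (cstar (w i).2) (w i).2))).

(* The norm of the C*-algebra M_n(L(X)), which acts faithfully on
   (X (+) A)^n; for n = 1, it is the norm of L(X). *)
Definition lk_mxnorm n (t : 'M[linking]_n) : \bar R :=
  opnorm (@xa_norm n) (@xa_norm n) (mxop (map_mx lk_act t)).

Definition lk_corner (x : X) : linking := Linking mod_compact0 x 0 0.

Definition mod_mxnorm n (x : 'M[X]_n) : \bar R :=
  lk_mxnorm (map_mx lk_corner x).

End LinkingAlgebra.

Arguments mod_compact {R A} X.
Arguments linking {R A} X.

(* X is completely isometrically isomorphic to B(E, F), for Hilbert spaces E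
   and F. Injectivity of Phi is the case n = 1. *)
Definition cisometric_ops (R : realType) (A : cstarAlgType R)
    (X : hilbertModType A) (E F : normedModType R[i]) : Prop :=
  exists Phi : X -> (E -> F),
    [/\ forall (c : R[i]) x y v, Phi (c *: x + y) v = c *: Phi x v + Phi y v,
        range Phi = bounded_ops E F
      & forall n (x : 'M[X]_n), ops_mxnorm (map_mx Phi x) = mod_mxnorm x].

(* H^c = B(C, H) and H^r = B(H, C). *)
Definition cisometric_col (R : realType) (A : cstarAlgType R)
    (X : hilbertModType A) (H : hilbertType R) : Prop :=
  cisometric_ops X R[i]^o H.

Definition cisometric_row (R : realType) (A : cstarAlgType R)
    (X : hilbertModType A) (H : hilbertType R) : Prop :=
  cisometric_ops X H R[i]^o.

Definition compact_ops (R : realType) (H : hilbertType R) : set (H -> H) :=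
  [set T | linear T /\ precompact (T @` [set x | `|x| <= 1])].

Arguments compact_ops {R} H.

Definition star_isomorphic_C (R : realType) (A : cstarAlgType R) : Prop :=
  exists phi : A -> R[i],
    [/\ bijective phi,
        forall (c : R[i]) a b, phi (c *: a + b) = c * phi a + phi b,
        forall a b, phi (cmul a b) = phi a * phi b
      & forall a, phi (cstar a) = Num.conj (phi a)].

Definition star_isomorphic_K (R : realType) (A : cstarAlgType R)
    (H : hilbertType R) : Prop :=
  exists phi : A -> (H -> H),
    [/\ injective phi, range phi = compact_ops H,
        forall (c : R[i]) a b v, phi (c *: a + b) v = c *: phi a v + phi b v,
        forall a b v, phi (cmul a b) v = phi a (phi b v)
      & forall a v w, hdot (phi a v) w = hdot v (phi (cstar a) w)].

(* Main.v *)
Require Import Defs.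
From mathcomp Require Import all_boot all_order all_algebra.
From mathcomp Require Import complex.
From mathcomp Require Import boolp classical_sets reals ereal.
From mathcomp Require Import topology normedtype.
From mathcomp Require Import finmap ring lra.

(* Transport the scalar product (.|.) of H to X. Comparing norms of y + ita.y in
   the two structures shows that A acts on the right by adjoints for (.|.), and
   the equality |x<x,x>| = |x|^3 then forces x<x,x> = |x|^2 x. Polarizing,
   x<y,z> + z<y,x> = (x|y)z + (z|y)x. For a unit vector e the Peirce projections
   e<e,.> and .<e,e> therefore add up to 1 + (.|e)e, and one of them must be the
   identity. If it is .<e,e>, then <y,z> = (z|y)<e,e>, so that A is a line and X
   a column. If it is e<e,.>, then x<y,z> = (x|y)z: an antiunitary X -> H, which
   exists because H has a conjugation, turns the right action of A into the
   norm closure of the finite rank operators, and X into a row. *)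

Set Implicit Arguments.
Unset Strict Implicit.
Unset Printing Implicit Defensive.

Import Order.TTheory GRing.Theory Num.Theory.
Import numFieldNormedType.Exports.
Import ComplexField.Normc.

Local Open Scope classical_set_scope.
Local Open Scope complex_scope.
Local Open Scope ring_scope.

(** * Norms *)

(** For self-adjoint a, the factor 1 + ita stands in for the unitary exp(ita), which would call for
    a functional calculus: the two agree to first order in t, and only that order matters, since an
    upper bound for |y + ita.y|^2 without a term linear in t forces (y.a|y) to be real. The bound
    itself rests on |<x,y>| <= |x||y|. Its usual proof goes through the order of [A]; here it comes
    from the parallelogram law of H. Positivity of <x,x> is used at a single point: equality in
    Cauchy-Schwarz gives x<x,x><x,x> = |x|^4 x, and positivity excludes the eigenvalue -|x|^2 of
    .<x,x>. Since [A] need not have a unit, its elements are reached by approximation through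
    fullness: in the column case with a contractive functional defined on all of [A], in the row
    case with the powers of a self-adjoint element, which show that the norm of [A] is the norm of
    its right action. The conjugation of H is there because a right action reverses products;
    passing to adjoints restores their order but is antilinear in a. *)

Section RealNorm.
Context {R : realType} {V : normedModType R[i]}.
Implicit Types (u v : V) (c : R[i]).

Lemma normE v : `|v| = (rnorm v)%:C.
Proof. by rewrite /rnorm RRe_real // ger0_real. Qed.

Lemma rnorm_ge0 v : 0 <= rnorm v.
Proof. by rewrite -ler0c -normE. Qed.

Lemma rnorm0 : rnorm (0 : V) = 0.
Proof. by rewrite /rnorm normr0. Qed.

Lemma rnorm0_eq0 v : rnorm v = 0 -> v = 0.
Proof. by move=> v0; apply/eqP; rewrite -normr_eq0 normE v0. Qed.

Lemma rnorm_le0 v : rnorm v <= 0 -> v = 0.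
Proof. by move=> v0; apply/rnorm0_eq0/le_anti; rewrite v0 rnorm_ge0. Qed.

Lemma rnormN v : rnorm (- v) = rnorm v.
Proof. by rewrite /rnorm normrN. Qed.

Lemma rnormB u v : rnorm (u - v) = rnorm (v - u).
Proof. by rewrite /rnorm distrC. Qed.

Lemma rnormD u v : rnorm (u + v) <= rnorm u + rnorm v.
Proof. by rewrite -lecR rmorphD /= -!normE ler_normD. Qed.

Lemma rnorm_triB u v w : rnorm (u - w) <= rnorm (u - v) + rnorm (v - w).
Proof. by rewrite -[u - w](subrKA v); apply: rnormD. Qed.

Lemma rnormZ c v : rnorm (c *: v) = normc c * rnorm v.
Proof.
by apply: complexI; rewrite -normE normrZ normE rmorphM.
Qed.

Lemma rnormZr (r : R) v : rnorm (r%:C *: v) = `|r| * rnorm v.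
Proof. by rewrite rnormZ /= expr0n addr0 sqrtr_sqr. Qed.

Lemma rnorm_sum (I : Type) (s : seq I) (F : I -> V) :
  rnorm (\sum_(i <- s) F i) <= \sum_(i <- s) rnorm (F i).
Proof.
elim/big_ind2: _ => [|x a y b xa yb|//]; first by rewrite rnorm0.
by apply: le_trans (rnormD _ _) (lerD xa yb).
Qed.

Lemma ball_rnorm (x y : V) (e : R) : ball x e%:C y = (rnorm (x - y) < e) :> Prop.
Proof. by rewrite -ball_normE /ball_ /= normE ltcR. Qed.

Lemma nbhs_rnormP (x : V) (P : set V) :
  nbhs x P <-> exists2 e : R, 0 < e & forall y, rnorm (x - y) < e -> P y.
Proof.
split=> [/nbhs_ballP[e /= e0 eP]|[e e0 eP]].
  have eE : e = (complex.Re e)%:C by rewrite RRe_real // gtr0_real.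
  exists (complex.Re e); first by rewrite -ltcR -eE.
  by move=> y xy; apply: eP; rewrite eE ball_rnorm.
apply/nbhs_ballP; exists e%:C => [/=|y]; first by rewrite ltcR.
by rewrite ball_rnorm; apply: eP.
Qed.

Lemma closure_rnormP (S : set V) (x : V) :
  closure S x <-> forall e : R, 0 < e -> exists2 y, S y & rnorm (x - y) < e.
Proof.
split=> [Sx e e0|Sx B /nbhs_rnormP[e e0 eB]].
  have [|y [Sy xy]] := Sx [set y | rnorm (x - y) < e]; last by exists y.
  by apply/nbhs_rnormP; exists e.
by have [y Sy xy] := Sx e e0; exists y; split=> //; apply: eB.
Qed.

End RealNorm.

Lemma rnorm_scalar (R : realType) (c : R[i]) : rnorm (c : R[i]^o) = normc c.
Proof. by rewrite /rnorm normc_def; case: c. Qed.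

Section Continuity.
Context {R : realType} {V W : normedModType R[i]}.

Lemma continuous_rnormP (f : V -> W) :
  continuous f <-> forall x (e : R), 0 < e ->
    exists2 d : R, 0 < d & forall y, rnorm (x - y) < d -> rnorm (f x - f y) < e.
Proof.
split=> [cf x e e0|cf x B /nbhs_rnormP[e e0 eB]].
  have /nbhs_rnormP : nbhs x (f @^-1` [set z | rnorm (f x - z) < e]).
    by apply: cf; apply/nbhs_rnormP; exists e.
  by case=> d d0 dP; exists d.
have [d d0 dP] := cf x e e0.
by apply/nbhs_rnormP; exists d => // y /dP/eB.
Qed.

Lemma linear_boundedP (f : V -> W) : linear f ->
  continuous f <-> exists2 M : R, 0 < M & forall x, rnorm (f x) <= M * rnorm x.
Proof.
move=> lf.
have f0 : f 0 = 0 by rewrite -[0 in LHS](addNr 0) -scaleN1r lf scaleN1r addNr.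
have fZ c x : f (c *: x) = c *: f x by rewrite -[c *: x]addr0 lf f0 addr0.
have fB x y : f (x - y) = f x - f y.
  by rewrite addrC -scaleN1r lf scaleN1r addrC.
rewrite continuous_rnormP; split=> [cf|[M M0 fM] x e e0].
  have [d d0 dP] := cf 0 1 ltr01.
  exists (2 / d) => [|x]; first by rewrite divr_gt0.
  have [->|/eqP x0] := eqVneq x 0; first by rewrite f0 !rnorm0 mulr0.
  have {}x0 : 0 < rnorm x.
    by rewrite lt_def rnorm_ge0 andbT; apply/eqP => /rnorm0_eq0.
  have r0 : 0 < d / (2 * rnorm x) by rewrite divr_gt0 // mulr_gt0.
  have /dP : rnorm (0 - (d / (2 * rnorm x))%:C *: x) < d.
    rewrite sub0r rnormN rnormZr gtr0_norm //.
    have -> : d / (2 * rnorm x) * rnorm x = d / 2 by field; rewrite gt_eqF.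
    by lra.
  rewrite f0 sub0r rnormN fZ rnormZr gtr0_norm // => /ltW.
  rewrite mulrC -ler_pdivlMr // div1r invfM invrK => /le_trans; apply.
  by have -> : d^-1 * (2 * rnorm x) = 2 / d * rnorm x by ring.
exists (e / M) => [|y xy]; first by rewrite divr_gt0.
rewrite -fB; apply: le_lt_trans (fM _) _.
by rewrite -ltr_pdivlMl // mulrC.
Qed.

End Continuity.

(** The sequences whose limits are taken below, minimizing ones in [real_projection] and approximate
    preimages in [phi_onto], come with a rate in 1/(m+1), which passes to the limit. *)
Lemma cauchy_rate (R : realType) (V : completeNormedModType R[i]) (c : R)
    (u : nat -> V) :
  (forall m n, (m <= n)%N -> rnorm (u m - u n) <= c / m.+1%:R) ->
  exists l, forall m, rnorm (u m - l) <= c / m.+1%:R.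
Proof.
move=> cu.
have uc : cvg (u @ \oo).
  apply: cauchy_cvg; apply: cauchy_exP => e e0.
  have eE : e = (complex.Re e)%:C by rewrite RRe_real // gtr0_real.
  have {}e0 : 0 < complex.Re e by rewrite -ltcR -eE.
  have [N cN] : exists N : nat, c / N.+1%:R < complex.Re e.
    exists (Num.truncn (`|c| / complex.Re e)).
    rewrite ltr_pdivrMr // mulrC -ltr_pdivrMr //.
    apply: le_lt_trans (truncnS_gt _); rewrite ler_pM2r ?invr_gt0 //.
    exact: ler_norm.
  exists (u N); exists N => // n /= Nn.
  by rewrite eE ball_rnorm; apply: le_lt_trans (cu _ _ Nn) cN.
exists (lim (u @ \oo)) => m; apply/ler_addgt0Pr => e e0.
have : nbhs (lim (u @ \oo)) [set z | rnorm (lim (u @ \oo) - z) < e].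
  by apply/nbhs_rnormP; exists e.
move=> /uc[N _ /(_ (maxn m N))] /= ul.
apply: le_trans (rnorm_triB _ (u (maxn m N)) _) _; apply: lerD.
  by apply: cu; rewrite leq_maxl.
by rewrite rnormB; apply/ltW/ul; rewrite /= leq_maxr.
Qed.
(** * Scalar products *)

Section ComplexModulus.
Context {R : realType}.
Implicit Types z w : R[i].

Lemma sqr_normcE z : normc z ^+ 2 = complex.Re z ^+ 2 + complex.Im z ^+ 2.
Proof. by case: z => a b /=; rewrite sqr_sqrtr // addr_ge0 ?sqr_ge0. Qed.

Lemma mulcJ z : z * z^* = (normc z ^+ 2)%:C.
Proof. by rewrite sqr_normcE; case: z => a b /=; simpc; congr (_ +i* _); ring. Qed.

Lemma normc_ge0 z : 0 <= normc z.
Proof. by case: z => a b; apply: sqrtr_ge0. Qed.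

Lemma Re_le_normc z : complex.Re z <= normc z.
Proof.
rewrite -[leRHS]ger0_norm ?normc_ge0 // -sqrtr_sqr sqr_normcE.
apply: le_trans (ler_norm _) _; rewrite -sqrtr_sqr; apply: ler_wsqrtr.
by rewrite lerDl sqr_ge0.
Qed.

Lemma ReD z w : complex.Re (z + w) = complex.Re z + complex.Re w.
Proof. by case: z; case: w. Qed.

Lemma ReN z : complex.Re (- z) = - complex.Re z.
Proof. by case: z. Qed.

Lemma ReJ z : complex.Re z^* = complex.Re z.
Proof. by case: z. Qed.

Lemma conjCR (r : R) : (r%:C)^* = r%:C.
Proof. exact: conjc_real. Qed.

Lemma ReMr (r : R) z : complex.Re (r%:C * z) = r * complex.Re z.
Proof. by case: z => a b; simpc. Qed.

Lemma normcR (r : R) : normc r%:C = `|r|.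
Proof. by rewrite /= expr0n addr0 sqrtr_sqr. Qed.

Lemma normc_conj z : normc z^* = normc z.
Proof. by case: z => a b /=; rewrite sqrrN. Qed.

End ComplexModulus.

(** A predicate on bare functions rather than a structure: besides [hdot] on H, it must hold for the
    form pulled back to X, whose type already carries a Hilbert module structure. *)
Record inner_product (R : realType) (V : normedModType R[i])
    (f : V -> V -> R[i]) : Prop := InnerProduct {
  ip_linear : forall c x y z, f (c *: x + y) z = c * f x z + f y z;
  ip_conj : forall x y, (f x y)^* = f y x;
  ip_norm : forall x, f x x = (rnorm x ^+ 2)%:C
}.

Lemma hdot_inner_product (R : realType) (H : hilbertType R) :
  inner_product (@hdot R H).
Proof.
split=> [c x y z|x y|x]; first by rewrite linearPl.
  by rewrite [RHS]hermC /= expr0 mul1r.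
by rewrite hdotE normE rmorphXn.
Qed.

Section InnerProduct.
Context {R : realType} {V : normedModType R[i]} {f : V -> V -> R[i]}.
Hypothesis ipf : inner_product f.
Implicit Types (x y z : V) (c : R[i]).

Lemma ip0l y : f 0 y = 0.
Proof.
have := ip_linear ipf 1 0 0 y.
rewrite scale1r addr0 mul1r => /eqP.
by rewrite -subr_eq0 opprD addrA subrr sub0r oppr_eq0 => /eqP.
Qed.

Lemma ipDl x y z : f (x + y) z = f x z + f y z.
Proof. by rewrite -{1}[x]scale1r (ip_linear ipf) mul1r. Qed.

Lemma ipZl c x z : f (c *: x) z = c * f x z.
Proof. by rewrite -[c *: x]addr0 (ip_linear ipf) ip0l addr0. Qed.

Lemma ipNl x z : f (- x) z = - f x z.
Proof. by rewrite -scaleN1r ipZl mulN1r. Qed.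

Lemma ipBl x y z : f (x - y) z = f x z - f y z.
Proof. by rewrite ipDl ipNl. Qed.

Lemma ipDr x y z : f x (y + z) = f x y + f x z.
Proof. by rewrite -(ip_conj ipf) ipDl rmorphD /= !(ip_conj ipf). Qed.

Lemma ipZr c x z : f x (c *: z) = c^* * f x z.
Proof. by rewrite -(ip_conj ipf) ipZl rmorphM /= !(ip_conj ipf). Qed.

Lemma ipZrR (r : R) x z : f x (r%:C *: z) = r%:C * f x z.
Proof. by rewrite ipZr conjCR. Qed.

Lemma ipNr x z : f x (- z) = - f x z.
Proof. by rewrite -(ip_conj ipf) ipNl rmorphN /= !(ip_conj ipf). Qed.

Lemma ipBr x y z : f x (y - z) = f x y - f x z.
Proof. by rewrite ipDr ipNr. Qed.

Lemma ip0r y : f y 0 = 0.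
Proof. by rewrite -(ip_conj ipf) ip0l rmorph0. Qed.

Lemma ip_suml (I : Type) (s : seq I) (F : I -> V) y :
  f (\sum_(i <- s) F i) y = \sum_(i <- s) f (F i) y.
Proof. by elim/big_rec2: _ => [|i a b _ <-]; rewrite ?ip0l ?ipDl. Qed.

Lemma ip_sumr (I : Type) (s : seq I) (F : I -> V) y :
  f y (\sum_(i <- s) F i) = \sum_(i <- s) f y (F i).
Proof. by elim/big_rec2: _ => [|i a b _ <-]; rewrite ?ip0r ?ipDr. Qed.

Lemma rnorm_sqE x : rnorm x ^+ 2 = complex.Re (f x x).
Proof. by rewrite (ip_norm ipf). Qed.

Lemma rnorm_sqD x y :
  rnorm (x + y) ^+ 2 = rnorm x ^+ 2 + rnorm y ^+ 2 + 2 * complex.Re (f x y).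
Proof.
by rewrite !rnorm_sqE ipDl !ipDr !ReD -(ip_conj ipf x y) ReJ; ring.
Qed.

Lemma rnorm_sqB x y :
  rnorm (x - y) ^+ 2 = rnorm x ^+ 2 + rnorm y ^+ 2 - 2 * complex.Re (f x y).
Proof. by rewrite rnorm_sqD rnormN ipNr ReN mulrN. Qed.

Lemma parallelogram x y :
  rnorm (x + y) ^+ 2 + rnorm (x - y) ^+ 2 = 2 * (rnorm x ^+ 2 + rnorm y ^+ 2).
Proof. by rewrite rnorm_sqD rnorm_sqB; ring. Qed.


Lemma ip_nondegenerate x : (forall y, f x y = 0) -> x = 0.
Proof.
move=> x0; apply: rnorm0_eq0; apply/eqP.
by rewrite -sqrf_eq0 rnorm_sqE x0.
Qed.

Lemma ip_inj x y : (forall z, f x z = f y z) -> x = y.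
Proof.
move=> xy; apply/eqP; rewrite -subr_eq0; apply/eqP.
by apply: ip_nondegenerate => z; rewrite ipBl xy subrr.
Qed.

Lemma Re_cauchy_schwarz x y : complex.Re (f x y) <= rnorm x * rnorm y.
Proof.
have [x0|x0] := leP (rnorm x) 0.
  by rewrite (rnorm_le0 x0) ip0l rnorm0 mul0r.
have [y0|y0] := leP (rnorm y) 0.
  by rewrite (rnorm_le0 y0) ip0r rnorm0 mulr0.
have xy0 := mulr_gt0 x0 y0; rewrite -(ler_pM2l xy0).
have := sqr_ge0 (rnorm ((rnorm y)%:C *: x - (rnorm x)%:C *: y)).
rewrite rnorm_sqB !rnormZr !gtr0_norm // ipZl ipZrR mulrCA !ReMr.
by nra.
Qed.

Lemma cauchy_schwarz x y : normc (f x y) <= rnorm x * rnorm y.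
Proof.
have [f0|f0] := leP (normc (f x y)) 0.
  by apply: le_trans f0 _; rewrite mulr_ge0 ?rnorm_ge0.
have := Re_cauchy_schwarz ((f x y)^* *: x) y.
rewrite ipZl mulrC mulcJ rnormZ normc_conj /= expr2 -mulrA.
by rewrite ler_pM2l.
Qed.

End InnerProduct.
(** * Hilbert spaces *)

Lemma le_add_divS (R : realType) (x y c : R) :
  (forall n, x <= y + c / n.+1%:R) -> x <= y.
Proof.
move=> xy; apply/ler_addgt0Pr => e e0.
apply: le_trans (xy (Num.truncn (`|c| / e))) _; rewrite lerD2l.
rewrite ler_pdivrMr // mulrC -ler_pdivrMr //; apply: ltW.
apply: le_lt_trans (truncnS_gt _); rewrite ler_pM2r ?invr_gt0 //.
exact: ler_norm.
Qed.

(** First-order condition, used for minimality in [real_projection] and for [ip_mact_selfadjoint].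
    The test value p/(q+1) is the optimal p/q made safe for q = 0. *)
Lemma eq0_of_quadratic_le (R : realType) (p q : R) : 0 <= q ->
  (forall t, 2 * t * p <= t ^+ 2 * q) -> p = 0.
Proof.
move=> q0 /(_ (p / (q + 1))); have Q0 : 0 < q + 1 by lra.
rewrite expr_div_n mulrA -(ler_pM2r (exprn_gt0 2 Q0)).
have -> : 2 * p / (q + 1) * p * (q + 1) ^+ 2 = 2 * p ^+ 2 * (q + 1).
  by field; rewrite gt_eqF.
have -> : p ^+ 2 / (q + 1) ^+ 2 * q * (q + 1) ^+ 2 = p ^+ 2 * q.
  by field; rewrite gt_eqF.
move=> pq; apply/eqP; rewrite -sqrf_eq0; apply/eqP/le_anti.
by rewrite sqr_ge0 andbT; have := sqr_ge0 p; nra.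
Qed.

Section HilbertSpace.
Context {R : realType} {V : completeNormedModType R[i]}.
Context {f : V -> V -> R[i]} (ipf : inner_product f).
Implicit Types (x y z : V) (c : R[i]).

(** Formulated for real subspaces, hence with real parts only, so as to serve both the kernel of a
    functional in [riesz] and the real form in [antiunitary_involution]. *)
Lemma real_projection (S : set V) : S 0 -> (forall x y, S x -> S y -> S (x + y)) ->
  (forall (r : R) x, S x -> S (r%:C *: x)) -> closure S `<=` S ->
  forall h, exists2 s, S s & forall y, S y -> complex.Re (f (h - s) y) = 0.
Proof.
move=> S0 SD SZ Scl h.
pose D := [set rnorm (h - s) ^+ 2 | s in S].
have D0 : lbound D 0 by move=> _ [s _ <-]; apply: sqr_ge0.
have Dinf : has_inf D by split; [exists (rnorm (h - 0) ^+ 2); exists 0|exists 0].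
have dle s : S s -> inf D <= rnorm (h - s) ^+ 2.
  by move=> Ss; apply: ge_inf => //; [exists 0|exists s].
have d0 : 0 <= inf D by apply: lb_le_inf => //; case: Dinf.
have /choice[s sP] (n : nat) :
    exists s, S s /\ rnorm (h - s) ^+ 2 <= inf D + n.+1%:R^-1 ^+ 2.
  have [|_ [s Ss <-] sle] := inf_adherent (eps := n.+1%:R^-1 ^+ 2) _ Dinf.
    by rewrite exprn_gt0 // invr_gt0.
  by exists s; split=> //; apply: ltW.
(* The midpoint of s m and s n lies in S, so the parallelogram law bounds |s m - s n|^2 by 2/(m+1)^2
   + 2/(n+1)^2, at most (2/(m+1))^2. This is why the excess of s n was taken quadratic. *)
have [|l lP] := cauchy_rate (u := s) (c := 2).
  move=> m n mn.
  have [Sm hm] := sP m; have [Sn hn] := sP n.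
  have le_nm : n.+1%:R^-1 ^+ 2 <= m.+1%:R^-1 ^+ 2 :> R.
    by rewrite ler_sqr ?nnegrE ?invr_ge0 // lef_pV2 ?posrE // ler_nat.
  have := dle _ (SZ 2^-1 _ (SD _ _ Sm Sn)).
  have par := parallelogram ipf (h - s m) (h - s n).
  have e2 : rnorm (h - s m + (h - s n)) =
            2 * rnorm (h - (2^-1)%:C *: (s m + s n)).
    transitivity (rnorm (2%:C *: (h - (2^-1)%:C *: (s m + s n)))); last first.
      by rewrite rnormZr gtr0_norm.
    congr rnorm; rewrite scalerBr scalerA -rmorphM mulfV // scale1r.
    by rewrite rmorphD /= !rmorph1 scalerDl scale1r addrACA -opprD.
  have e3 : h - s m - (h - s n) = - (s m - s n).
    by rewrite opprB addrC addrA subrK opprB.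
  rewrite e2 e3 rnormN in par.
  move=> dm; rewrite -ler_sqr ?nnegrE ?rnorm_ge0 ?divr_ge0 //.
  move: par dm hm hn le_nm; rewrite !exprMn.
  move: (n.+1%:R^-1 ^+ 2) (m.+1%:R^-1 ^+ 2) => N M. by lra.
have Sl : S l.
  apply/Scl/closure_rnormP => e e0.
  exists (s (Num.truncn (2 / e))); first by case: (sP (Num.truncn (2 / e))).
  rewrite rnormB; apply: le_lt_trans (lP _) _.
  by rewrite ltr_pdivrMr // mulrC -ltr_pdivrMr // truncnS_gt.
have hl : rnorm (h - l) ^+ 2 <= inf D.
  rewrite -[leRHS]sqr_sqrtr // ler_sqr ?nnegrE ?rnorm_ge0 ?sqrtr_ge0 //.
  (* 3 = 1 + 2: the excess of |h - s n| over the infimum, plus the distance from s n to l. *)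
  apply: (@le_add_divS _ _ _ 3) => n; have [_ hn] := sP n.
  apply: le_trans (rnorm_triB _ (s n) _) _.
  have n0 : 0 <= n.+1%:R^-1 :> R by rewrite invr_ge0.
  have : rnorm (h - s n) <= Num.sqrt (inf D) + n.+1%:R^-1.
    rewrite -ler_sqr ?nnegrE ?rnorm_ge0 ?addr_ge0 ?sqrtr_ge0 //.
    apply: le_trans hn _; rewrite sqrrD sqr_sqrtr // lerD2r lerDl.
    by rewrite mulrn_wge0 // mulr_ge0 ?sqrtr_ge0.
  by move: (lP n) n0; move: (n.+1%:R^-1) => k; lra.
exists l => // y Sy; apply: (@eq0_of_quadratic_le _ _ (rnorm y ^+ 2)).
  exact: sqr_ge0.
move=> t; have := dle _ (SD _ _ Sl (SZ t _ Sy)).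
rewrite opprD addrA (rnorm_sqB ipf) rnormZr exprMn real_normK ?num_real //.
by rewrite (ipZrR ipf) ReMr; move: hl; lra.
Qed.

Lemma riesz (g : V -> R[i]) (M : R) : linear (g : V -> R[i]^o) ->
  (forall x, normc (g x) <= M * rnorm x) -> exists w, forall v, g v = f v w.
Proof.
move=> lg gM.
have gL c x y : g (c *: x + y) = c * g x + g y by rewrite lg.
have g0 : g 0 = 0 by rewrite -[0 in LHS](addNr 0) -scaleN1r gL mulN1r addNr.
have gZ c x : g (c *: x) = c * g x by rewrite -[c *: x]addr0 gL g0 addr0.
have gD x y : g (x + y) = g x + g y by rewrite -{1}[x]scale1r gL mul1r.
have gN x : g (- x) = - g x by rewrite -scaleN1r gZ mulN1r.
have [g_eq0|/existsNP[h gh]] := pselect (forall x, g x = 0).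
  by exists 0 => v; rewrite (ip0r ipf).
have [||||s Ss sP] := @real_projection [set x | g x = 0] _ _ _ _ h.
- by [].
- by move=> x y /= gx gy; rewrite gD gx gy addr0.
- by move=> r x /= gx; rewrite gZ gx mulr0.
- move=> x /closure_rnormP xcl /=; apply: eq0_normc; apply/le_anti.
  rewrite normc_ge0 andbT; apply/ler_addgt0Pr => e e0; rewrite add0r.
  have M1 : 0 < `|M| + 1 by rewrite ltr_wpDl.
  have [|y /= gy xy] := xcl (e / (`|M| + 1)); first exact: divr_gt0.
  have -> : g x = g (x - y) by rewrite gD gN gy subr0.
  apply: le_trans (gM _) _.
  have := ler_norm M; move: xy; rewrite ltr_pdivlMr //.
  by have := rnorm_ge0 (x - y); nra.
(* The kernel is a complex subspace: testing with iy as well turns the vanishing of the real part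
   into orthogonality. *)
have sP0 y : g y = 0 -> f (h - s) y = 0.
  move=> gy; have := sP _ gy; have := sP ('i%C *: y).
  rewrite /= gZ gy mulr0 => /(_ erefl); rewrite (ipZr ipf).
  by case: (f _ y) => a b /=; rewrite !mul0r !mulN1r sub0r opprK => -> ->.
set u := h - s in sP0.
have gu : g u = g h by rewrite /u gD gN Ss subr0.
have u0 : f u u != 0.
  apply: contra_not_neq gh; rewrite -gu (ip_norm ipf) => /complexI/eqP.
  by rewrite sqrf_eq0 => /eqP/rnorm0_eq0 ->.
exists ((g u / f u u)^* *: u) => v.
have := sP0 (v - (g v / g u) *: u).
rewrite gD gN gZ divfK ?gu; last exact/eqP.
rewrite subrr => /(_ erefl)/eqP; rewrite (ipBr ipf) (ipZr ipf) subr_eq0 => /eqP.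
move/(congr1 Num.conj); rewrite rmorphM /= conjCK !(ip_conj ipf) => fvu.
rewrite (ipZr ipf) conjCK fvu; field. by rewrite u0 andbT; apply/eqP.
Qed.

End HilbertSpace.

(** * Conjugations of a Hilbert space *)

Section Conjugation.
Context {R : realType} {V : completeNormedModType R[i]}.
Context {f : V -> V -> R[i]} (ipf : inner_product f).
Implicit Types (x y z : V) (c : R[i]).

(* A set that is maximal for having real pairwise inner products is a closed
   real subspace S with V = S + iS, and the conjugation is s + it |-> s - it. *)
Lemma maximal_real_set : exists S : set V,
  (forall x y, S x -> S y -> complex.Im (f x y) = 0) /\
  (forall x, (forall y, S y -> complex.Im (f x y) = 0) -> S x).
Proof.
pose P (S : set V) := forall x y, S x -> S y -> complex.Im (f x y) = 0.
have [F FP Ftot|S [SP Smax]] := @Zorn_bigcup _ P.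
  move=> x y [A FA Ax] [B FB By].
  by case: (Ftot _ _ FA FB) => sub; [apply: (FP B)|apply: (FP A)] => //; apply: sub.
exists S; split=> // x xS; apply: contrapT => nSx.
apply: (Smax (S `|` [set x])); last first.
  have Imxx : complex.Im (f x x) = 0 by rewrite (ip_norm ipf).
  have Sx y : S y -> complex.Im (f y x) = 0.
    move=> /xS; rewrite -(ip_conj ipf y); case: (f y x) => a b /= /eqP.
    by rewrite oppr_eq0 => /eqP.
  by move=> y z [Sy|->] [Sz|->] //; [exact: SP|exact: Sx|exact: xS].
by split=> [y Sy|sub]; [left|apply/nSx/sub; right].
Qed.

Lemma antiunitary_involution : exists J : V -> V,
  [/\ forall c x y, J (c *: x + y) = c^* *: J x + J y, involutive J
    & forall x y, f (J x) (J y) = f y x].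
Proof.
have [S [Sre Smax]] := maximal_real_set.
have ImD (z w : R[i]) : complex.Im (z + w) = complex.Im z + complex.Im w.
  by case: z; case: w.
have ImMr (r : R) (z : R[i]) : complex.Im (r%:C * z) = r * complex.Im z.
  by case: z => a b; simpc.
have S0 : S 0 by apply: Smax => y Sy; rewrite (ip0l ipf).
have SD x y : S x -> S y -> S (x + y).
  by move=> Sx Sy; apply: Smax => z Sz; rewrite (ipDl ipf) ImD !Sre ?addr0.
have SZ (r : R) x : S x -> S (r%:C *: x).
  by move=> Sx; apply: Smax => z Sz; rewrite (ipZl ipf) ImMr Sre ?mulr0.
have SN x : S x -> S (- x).
  by move=> /(SZ (-1)); rewrite rmorphN rmorph1 scaleN1r.
have Scl : closure S `<=` S.
  move=> x /closure_rnormP xcl; apply: Smax => y Sy.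
  have Imle (z : R[i]) : `|complex.Im z| <= normc z.
    by case: z => a b /=; rewrite -sqrtr_sqr; apply: ler_wsqrtr; rewrite lerDr sqr_ge0.
  apply/normr0_eq0/le_anti; rewrite normr_ge0 andbT.
  apply/ler_addgt0Pr => e e0; rewrite add0r.
  have y1 : 0 < rnorm y + 1 by rewrite ltr_wpDl ?rnorm_ge0.
  have [|z Sz xz] := xcl (e / (rnorm y + 1)); first exact: divr_gt0.
  have -> : complex.Im (f x y) = complex.Im (f (x - z) y).
    by rewrite -[in LHS](subrK z x) (ipDl ipf) ImD (Sre z) // addr0.
  apply: le_trans (Imle _) _; apply: le_trans (cauchy_schwarz ipf _ _) _.
  move: xz; rewrite ltr_pdivlMr //.
  by have := rnorm_ge0 (x - z); nra.
have ii : 'i%C * 'i%C = -1 :> R[i] by rewrite -expr2 sqr_i.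
have iJ : 'i%C^* = - 'i%C :> R[i] by rewrite /= -[LHS]/(conjc _); simpc.
(* The real projection s of h leaves Re (h - s|y) = 0 for y in S; thus -i(h - s) has real products
   with S and lies in S by maximality. *)
have decomp h : exists st, [/\ S st.1, S st.2 & h = st.1 + 'i%C *: st.2].
  have [s Ss sP] := real_projection ipf S0 SD SZ Scl h.
  exists (s, - 'i%C *: (h - s)); split=> //=.
    apply: Smax => y /sP; rewrite (ipZl ipf).
    by case: (f _ y) => a b /= ->; rewrite oppr0 mul0r mulr0 add0r.
  by rewrite scalerA mulrN ii opprK scale1r addrC subrK.
(* |s|^2 = (s|it) = -i(s|t) is both real and purely imaginary. *)
have Si0 s t : S s -> S t -> s = 'i%C *: t -> s = 0.
  move=> Ss St st; apply/rnorm0_eq0/eqP; rewrite -sqrf_eq0 (rnorm_sqE ipf).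
  rewrite {2}st (ipZr ipf) iJ; have := Sre _ _ Ss St.
  by case: (f s t) => a b /= ->; rewrite oppr0 mul0r mulr0 subr0.
have uniq s t s' t' : S s -> S t -> S s' -> S t' ->
    s + 'i%C *: t = s' + 'i%C *: t' -> s = s' /\ t = t'.
  move=> Ss St Ss' St' e.
  have ss' : s = s'.
    apply/eqP; rewrite -subr_eq0; apply/eqP/(@Si0 _ (t' - t)).
    - by apply/SD/SN.
    - by apply/SD/SN.
    - by rewrite scalerBr; apply/eqP; rewrite subr_eq addrAC -subr_eq opprK e addrC.
  split=> //; move/eqP: e; rewrite ss' (inj_eq (addrI _)) => /eqP.
  by move/(congr1 ( *:%R (- 'i%C))); rewrite !scalerA mulNr ii opprK !scale1r.
have [d dP] := choice decomp.
pose J h := (d h).1 - 'i%C *: (d h).2.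
have JE s t : S s -> S t -> J (s + 'i%C *: t) = s - 'i%C *: t.
  move=> Ss St; rewrite /J.
  have [S1 S2] := dP (s + 'i%C *: t).
  by move=> /(uniq _ _ _ _ Ss St S1 S2)[<- <-].
exists J; split=> [c x y|x|x y].
- have [Ss St ->] := dP x; have [Ss' St' ->] := dP y.
  move: (d x).1 (d x).2 (d y).1 (d y).2 Ss St Ss' St' => s t s' t' Ss St Ss' St'.
  case: c => a b.
  have cE : a +i* b = a%:C + 'i%C * b%:C by exact: (complexE (a +i* b)).
  have cJ : (a +i* b)^* = a%:C - 'i%C * b%:C.
    by rewrite cE rmorphD rmorphM /= !conjCR iJ mulNr.
  rewrite !JE // cJ cE.
  (* Vectors are compared through their products with every z, where [ring] applies modulo i^2 =
     -1. *)
  have -> : (a%:C + 'i%C * b%:C) *: (s + 'i%C *: t) + (s' + 'i%C *: t') =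
     (a%:C *: s + (- b)%:C *: t + s') + 'i%C *: (b%:C *: s + a%:C *: t + t').
    apply: (ip_inj ipf) => z; rewrite !(ipDl ipf, ipZl ipf).
    by rewrite rmorphN; ring: ii.
  have S1 := SD _ _ (SD _ _ (SZ a _ Ss) (SZ (- b) _ St)) Ss'.
  have S2 := SD _ _ (SD _ _ (SZ b _ Ss) (SZ a _ St)) St'.
  rewrite (JE _ _ S1 S2).
  apply: (ip_inj ipf) => z; rewrite !(ipDl ipf, ipZl ipf, ipNl ipf).
  by rewrite rmorphN; ring: ii.
- have [Ss St xE] := dP x; rewrite [RHS]xE.
  have -> : J x = (d x).1 + 'i%C *: - (d x).2 by rewrite /J scalerN.
  by rewrite JE ?scalerN ?opprK //; apply: SN.
- have [Ss St ->] := dP x; have [Ss' St' ->] := dP y.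
  move: (d x).1 (d x).2 (d y).1 (d y).2 Ss St Ss' St' => s t s' t' Ss St Ss' St'.
  rewrite !JE // !(ipBl ipf, ipDl ipf, ipBr ipf, ipDr ipf, ipZl ipf, ipZr ipf) iJ.
  have sym a b : S a -> S b -> f b a = f a b.
    move=> Sa Sb; rewrite -(ip_conj ipf a); have := Sre _ _ Sa Sb.
    by case: (f a b) => p q /= ->; rewrite -[LHS]/(conjc _) /= oppr0.
  rewrite (sym s s') // (sym s t') // (sym t s') // (sym t t') //.
  by ring.
Qed.

End Conjugation.
(** * Compact operators *)

Definition totally_bounded (R : realType) (V : normedModType R[i]) (C : set V) :=
  forall e : R, 0 < e -> exists s : seq V,
    forall x, C x -> exists2 y, y \in s & rnorm (x - y) < e.

Lemma ultra_has (T : Type) (I : eqType) (F : set_system T) (P : I -> set T)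
    (s : seq I) : UltraFilter F ->
  F [set x | exists2 i, i \in s & P i x] -> exists2 i, i \in s & F (P i).
Proof.
move=> UF; elim: s => [|i s IHs] Fs.
  by have /filter_ex[x [j]] := Fs.
have [Fi|Fi] := in_ultra_setVsetC (P i) UF; first by exists i; rewrite ?mem_head.
have [|j js Fj] := IHs; last by exists j; rewrite // inE js orbT.
apply: filterS (filterI Fs Fi) => x [[j]].
by rewrite inE => /predU1P[->|js] //; exists j.
Qed.

(** An ultrafilter containing the closure of C contains, for each radius, one of the finitely many
    balls that cover it; it is therefore Cauchy, and completeness gives the limit. *)
Lemma totally_bounded_precompact (R : realType) (V : completeNormedModType R[i])
    (C : set V) : totally_bounded C -> precompact C.
Proof.
move=> tbC; rewrite precompactE compact_ultra => F UF FC.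
suff cvF : cvg F.
  by exists (lim F); split=> //; apply: (closed_cvg _ _ FC) => //; apply: closed_closure.
apply: cauchy_cvg; apply: cauchy_exP => e e0.
have eE : e = (complex.Re e)%:C by rewrite RRe_real // gtr0_real.
have {}e0 : 0 < complex.Re e by rewrite -ltcR -eE.
have [s sP] := tbC (complex.Re e / 2) (divr_gt0 e0 (ltr0Sn _ 1)).
have [|y _ Fy] := @ultra_has _ _ F (fun y => [set x | rnorm (x - y) < complex.Re e]) s UF.
  apply: filterS FC => x /closure_rnormP/(_ _ (divr_gt0 e0 (ltr0Sn _ 1)))[z Cz xz].
  have [y ys zy] := sP z Cz; exists y => //=.
  by apply: le_lt_trans (rnorm_triB _ z _) _; lra.
exists y; rewrite eE; apply: filterS Fy => x /=.
by rewrite ball_rnorm rnormB.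
Qed.

Lemma precompact_totally_bounded (R : realType) (V : normedModType R[i])
    (C : set V) : precompact C -> totally_bounded C.
Proof.
rewrite precompactE compact_cover => cC e e0.
have [i _||D _ CD] := cC V setT (fun y => [set x | rnorm (y - x) < e]°).
- exact: open_interior.
- move=> x _; exists x => //; apply/nbhs_rnormP; exists e => //.
exists (enum_fset D) => x /subset_closure/CD[y Dy /interior_subset /= yx].
by exists y; rewrite // rnormB.
Qed.

Section FiniteRank.
Context {R : realType} {V : completeNormedModType R[i]}.
Context {f : V -> V -> R[i]} (ipf : inner_product f).

Definition finite_rank (ps : seq (V * V)) (v : V) : V :=
  \sum_(p <- ps) f v p.2 *: p.1.

Lemma segment_net (M e : R) : 0 < e -> exists s : seq R,
  forall a, `|a| <= M -> exists2 b, b \in s & `|a - b| < e.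
Proof.
move=> e0; exists [seq k%:R * e - M | k <- iota 0 (Num.truncn (2 * M / e)).+1].
move=> a aM; have /andP[Ma aM'] : (- M <= a) && (a <= M) by rewrite -ler_norml.
have k0 : 0 <= (a + M) / e by apply: divr_ge0; lra.
exists ((Num.truncn ((a + M) / e))%:R * e - M).
  apply/mapP; exists (Num.truncn ((a + M) / e)) => //.
  rewrite mem_iota /= add0n ltnS.
  by apply: le_truncn; rewrite ler_pM2r ?invr_gt0 //; lra.
have /andP[l u] := truncn_itv k0.
move: l; rewrite ler_pdivlMr // => l.
move: u; rewrite ltr_pdivrMr // -natr1 [ltRHS]mulrDl mul1r => u.
by rewrite ltr_norml; apply/andP; split; lra.
Qed.

Lemma disc_net (M e : R) : 0 < e -> exists s : seq R[i],
  forall c, normc c <= M -> exists2 b, b \in s & normc (c - b) < e.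
Proof.
move=> e0; have [s sP] := segment_net M (divr_gt0 e0 (ltr0Sn _ 1)).
exists [seq a +i* b | a <- s, b <- s] => -[a b] cM.
have sq (x y : R) : `|x| <= normc (x +i* y) /\ `|y| <= normc (x +i* y).
  by rewrite /= -!sqrtr_sqr !ler_wsqrtr // ?lerDl ?lerDr sqr_ge0.
have [/le_trans/(_ cM)/sP[a' a's aa'] /le_trans/(_ cM)/sP[b' b's bb']] := sq a b.
exists (a' +i* b'); first exact: allpairs_f.
rewrite -ltr_sqr ?nnegrE ?normc_ge0 ?ltW // sqr_normcE /=.
move: aa' bb'; rewrite -(real_normK (num_real (a - a'))).
rewrite -(real_normK (num_real (b - b'))).
have := normr_ge0 (a - a'); have := normr_ge0 (b - b').
by nra.
Qed.

Lemma finite_rank_tb (ps : seq (V * V)) :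
  totally_bounded [set finite_rank ps v | v in [set v | rnorm v <= 1]].
Proof.
elim: ps => [|[x y] ps IHps] e e0.
  exists [:: 0] => _ [v _ <-]; exists 0; first exact: mem_head.
  by rewrite /finite_rank big_nil subrr rnorm0.
have e2 : 0 < e / 2 by apply: divr_gt0.
have [s sP] := IHps _ e2.
have x1 : 0 < rnorm x + 1 by rewrite ltr_wpDl ?rnorm_ge0.
have [r rP] := disc_net (rnorm y) (divr_gt0 e2 x1).
exists [seq c *: x + z | c <- r, z <- s] => _ [v v1 <-].
have [|z zs vz] := sP (finite_rank ps v); first by exists v.
have [|c cr vc] := rP (f v y).
  apply: le_trans (cauchy_schwarz ipf _ _) _.
  exact: ler_piMl (rnorm_ge0 y) v1.
exists (c *: x + z); first by apply: allpairs_f.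
rewrite /finite_rank big_cons /= opprD addrACA -scalerBl.
apply: le_lt_trans (rnormD _ _) _; rewrite rnormZ.
have : normc (f v y - c) * rnorm x <= e / 2.
  move: vc; rewrite ltr_pdivlMr //.
  by have := normc_ge0 (f v y - c); nra.
by move: vz; rewrite /finite_rank; lra.
Qed.

(** The closure of the finite rank operators for the operator norm, written with an estimate
    relative to |v| so that no norm on operators intervenes. *)
Definition approx_finite_rank (T : V -> V) := forall e : R, 0 < e ->
  exists ps, forall v, rnorm (T v - finite_rank ps v) <= e * rnorm v.

Lemma approx_finite_rank_tb (T : V -> V) : approx_finite_rank T ->
  totally_bounded [set T v | v in [set v | rnorm v <= 1]].
Proof.
move=> aT e e0; have e3 : 0 < e / 3 by apply: divr_gt0.
have [ps psP] := aT _ e3; have [s sP] := finite_rank_tb ps e3.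
exists s => _ [v v1 <-]; have [|y ys vy] := sP (finite_rank ps v); first by exists v.
exists y => //; apply: le_lt_trans (rnorm_triB _ (finite_rank ps v) _) _.
have := psP v; move: v1 vy => /=.
by have := rnorm_ge0 v; nra.
Qed.

Lemma gram_schmidt (s : seq V) : exists es : seq V,
  [/\ uniq es, forall x y, x \in es -> y \in es -> f x y = (x == y)%:R
    & forall y, y \in s -> \sum_(x <- es) f y x *: x = y].
Proof.
elim: s => [|y s [es [ues oes esP]]]; first by exists [::].
pose P v := \sum_(x <- es) f v x *: x.
have PE v x : x \in es -> f (P v) x = f v x.
  move=> xes; rewrite (ip_suml ipf) (bigD1_seq x) //= big_seq_cond.
  rewrite big1 => [|z /andP[zes zx]].
    by rewrite addr0 (ipZl ipf) (oes x x) // eqxx mulr1.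
  by rewrite (ipZl ipf) (oes z x) // (negPf zx) mulr0.
set u := y - P y.
have uo x : x \in es -> f u x = 0 by move=> xes; rewrite (ipBl ipf) PE // subrr.
(* A vector that depends on the previous ones has residue 0 and is dropped, so that [s] is
   arbitrary. *)
have [u0|u0] := eqVneq u 0.
  exists es; split=> // z; rewrite inE => /predU1P[->|/esP //].
  by apply/eqP; rewrite eq_sym -subr_eq0 -/(P y) -/u u0.
have uu : f u u != 0.
  apply: contra_neq u0; rewrite (ip_norm ipf) => /complexI/eqP.
  by rewrite sqrf_eq0 => /eqP/rnorm0_eq0.
have nu : rnorm u != 0 by apply: contra_neq u0 => /rnorm0_eq0.
pose w := (rnorm u)^-1%:C *: u.
have wo x : x \in es -> f w x = 0 by move=> xes; rewrite (ipZl ipf) uo // mulr0.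
have ww : f w w = 1.
  rewrite (ipZl ipf) (ipZrR ipf) (ip_norm ipf) -!rmorphM /= expr2.
  by rewrite mulrA mulrA -(mulrA _ _ (rnorm u)) mulrC mulrA; congr _%:C; field.
have wes : w \notin es.
  by apply/negP => /wo; rewrite ww => /eqP; rewrite oner_eq0.
have wo' x : x \in es -> f x w = 0.
  by move=> xes; rewrite -(ip_conj ipf) wo // conjC0.
exists (w :: es); split=> [|a b|z].
- by rewrite /= wes.
- rewrite !inE => /predU1P[->|aes] /predU1P[->|bes].
  + by rewrite eqxx ww.
  + by rewrite wo // (negPf (memPnC wes _ bes)).
  + by rewrite wo' // eq_sym (negPf (memPnC wes _ aes)).
  + exact: oes.
- rewrite inE big_cons => /predU1P[->|zs]; rewrite -/(P _).
    have -> : f y w *: w = u; last by rewrite subrK.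
    have fyu : f y u = f u u.
      have -> : f u u = f y u - f (P y) u by rewrite {1}/u (ipBl ipf).
      rewrite (ip_suml ipf) big_seq big1 ?subr0 // => x xes.
      by rewrite (ipZl ipf) -(ip_conj ipf u) uo // conjC0 mulr0.
    rewrite (ipZrR ipf) fyu (ip_norm ipf) scalerA -!rmorphM /=.
    rewrite -[RHS]scale1r; congr (_ *: _); rewrite -(rmorph1 (real_complex R)).
    by congr _%:C; field.
  have -> : f z w = 0.
    rewrite -(esP z zs) (ip_suml ipf) big_seq big1 // => x xes.
    by rewrite (ipZl ipf) wo' // mulr0.
  by rewrite scale0r add0r; apply: esP.
Qed.

(** Let P be the orthogonal projection onto the span of a finite net of the image of the ball. As 1
    - P is a contraction that kills the net, PT is within e of T on the ball. *)
Lemma tb_approx_finite_rank (T : V -> V) : linear T ->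
  totally_bounded [set T v | v in [set v | rnorm v <= 1]] -> approx_finite_rank T.
Proof.
move=> lT tbT.
have T0 : T 0 = 0 by rewrite -[0 in LHS](addNr 0) -scaleN1r lT scaleN1r addNr.
have TZ c x : T (c *: x) = c *: T x by rewrite -[c *: x]addr0 lT T0 addr0.
have scale (S : V -> V) (M : R) : (forall c x, S (c *: x) = c *: S x) ->
    (forall v, rnorm v <= 1 -> rnorm (S v) <= M) ->
    forall v, rnorm (S v) <= M * rnorm v.
  move=> SZ SM v; have [v0|v0] := leP (rnorm v) 0.
    by rewrite (rnorm_le0 v0) -[X in S X](scale0r 0) SZ scale0r rnorm0 mulr0.
  have := SM ((rnorm v)^-1%:C *: v).
  rewrite SZ !rnormZr gtr0_norm ?invr_gt0 // mulVf ?gt_eqF // => /(_ (lexx _)).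
  by rewrite mulrC ler_pdivrMr.
have [M TM] : exists M, forall v, rnorm (T v) <= M * rnorm v.
  have [s sP] := tbT 1 ltr01.
  exists (\sum_(y <- s) rnorm y + 1); apply: scale => // v v1.
  have [|y ys vy] := sP (T v); first by exists v.
  rewrite -[T v](subrK y) addrC; apply: le_trans (rnormD _ _) _.
  apply: lerD; last exact: ltW.
  elim: s ys {sP} => // z s IHs; rewrite inE big_cons => /predU1P[->|/IHs yz].
    by rewrite lerDl sumr_ge0 // => ? _; apply: rnorm_ge0.
  by apply: le_trans yz _; rewrite lerDr rnorm_ge0.
(* [g] is the adjoint of T; it puts PT in the format of [finite_rank], as the sum of the operators v
   |-> (v|g x)x. *)
have /choice[g gP] (e : V) : exists w, forall v, f (T v) e = f v w.
  apply: (riesz ipf (M := M * rnorm e)) => [c x y|x].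
    by rewrite lT (ipDl ipf) (ipZl ipf).
  apply: le_trans (cauchy_schwarz ipf _ _) _; rewrite mulrAC.
  by rewrite ler_wpM2r ?rnorm_ge0.
move=> e e0; have [s sP] := tbT e e0.
have [es [ues oes esP]] := gram_schmidt s.
exists [seq (x, g x) | x <- es].
pose P v := \sum_(x <- es) f v x *: x.
have PE v : finite_rank [seq (x, g x) | x <- es] v = P (T v).
  by rewrite /finite_rank big_map; apply: eq_bigr => x _; rewrite gP.
have Porth v x : x \in es -> f (v - P v) x = 0.
  move=> xes; rewrite (ipBl ipf) (ip_suml ipf) (bigD1_seq x) //=.
  rewrite big_seq_cond big1 => [|z /andP[zes zx]].
    by rewrite addr0 (ipZl ipf) (oes x x) // eqxx mulr1 subrr.
  by rewrite (ipZl ipf) (oes z x) // (negPf zx) mulr0.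
have Pc v : rnorm (v - P v) <= rnorm v.
  have -> : rnorm v = rnorm (v - P v + P v) by rewrite subrK.
  rewrite -ler_sqr ?nnegrE ?rnorm_ge0 // (rnorm_sqD ipf (v - P v)).
  have -> : f (v - P v) (P v) = 0.
    rewrite {2}/P (ip_sumr ipf) big_seq big1 // => x xes.
    by rewrite (ipZr ipf) Porth // mulr0.
  by rewrite mulr0 addr0 lerDl sqr_ge0.
have PB v w : P (v - w) = P v - P w.
  rewrite /P -sumrB; apply: eq_bigr => x _.
  by rewrite (ipBl ipf) scalerBl.
have PZ c v : P (c *: v) = c *: P v.
  by rewrite /P scaler_sumr; apply: eq_bigr => x _; rewrite (ipZl ipf) scalerA.
move=> v; rewrite PE; apply: (scale (fun v => T v - P (T v))) => [c x|{}v v1].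
  by rewrite TZ PZ scalerBr.
have [|y ys vy] := sP (T v); first by exists v.
have -> : T v - P (T v) = (T v - y) - P (T v - y).
  by rewrite PB [P y]esP // opprB addrA subrK.
exact: le_trans (Pc _) (ltW vy).
Qed.

End FiniteRank.

Lemma compact_opsP (R : realType) (H : hilbertType R) (T : H -> H) : linear T ->
  compact_ops H T <-> approx_finite_rank (f := @hdot R H) T.
Proof.
have ipH := hdot_inner_product H.
have bE : [set x : H | `|x| <= 1] = [set x | rnorm x <= 1].
  by apply/seteqP; split=> x /=; rewrite normE -lecR.
move=> lT; rewrite /compact_ops /= bE; split=> [[_ pT]|aT].
  exact/(tb_approx_finite_rank ipH lT)/precompact_totally_bounded.
by split=> //; apply/totally_bounded_precompact/(approx_finite_rank_tb ipH).
Qed.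
(** * Hilbert modules with a Hilbertian norm *)

Section CStarNorm.
Context {R : realType} {A : cstarAlgType R}.
Implicit Types (a b : A) (c : R[i]).

Lemma cmul0l a : cmul 0 a = 0.
Proof. by rewrite -(scale0r (0 : A)) cmulZl !scale0r. Qed.

Lemma cmul0r a : cmul a 0 = 0.
Proof. by rewrite -(scale0r (0 : A)) cmulZr !scale0r. Qed.

Lemma cmulNl a b : cmul (- a) b = - cmul a b.
Proof. by rewrite -scaleN1r cmulZl scaleN1r. Qed.

Lemma cmulNr a b : cmul a (- b) = - cmul a b.
Proof. by rewrite -scaleN1r cmulZr scaleN1r. Qed.

Lemma cmulBl a b d : cmul (a - b) d = cmul a d - cmul b d.
Proof. by rewrite cmulDl cmulNl. Qed.

Lemma cmul_suml (I : Type) (s : seq I) (F : I -> A) a :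
  cmul (\sum_(i <- s) F i) a = \sum_(i <- s) cmul (F i) a.
Proof. by elim/big_rec2: _ => [|i x y _ <-]; rewrite ?cmul0l ?cmulDl. Qed.

Lemma cstar0 : cstar (0 : A) = 0.
Proof. by rewrite -(scale0r (0 : A)) cstarZ conjC0 !scale0r. Qed.

Lemma cstarN a : cstar (- a) = - cstar a.
Proof. by rewrite -scaleN1r cstarZ rmorphN1 scaleN1r. Qed.

Lemma rnormM a b : rnorm (cmul a b) <= rnorm a * rnorm b.
Proof. by rewrite -lecR rmorphM /= -!normE cnormM. Qed.

Lemma rnorm_starM a : rnorm (cmul (cstar a) a) = rnorm a ^+ 2.
Proof. by apply: complexI; rewrite rmorphXn /= -!normE cnorm_star. Qed.

Lemma rnorm_cstar a : rnorm (cstar a) = rnorm a.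
Proof.
have le b : rnorm b <= rnorm (cstar b).
  have [b0|b0] := leP (rnorm b) 0; first exact: le_trans b0 (rnorm_ge0 _).
  by rewrite -(ler_pM2r b0) -expr2 -rnorm_starM rnormM.
by apply/le_anti; rewrite le andbT -{2}(cstarK a) le.
Qed.

Lemma rnorm_Mstar a : rnorm (cmul a (cstar a)) = rnorm a ^+ 2.
Proof. by rewrite -{1}(cstarK a) rnorm_starM rnorm_cstar. Qed.

(** The lower bound is |a|^4 = |a^4| <= |a^3||a|, the equality being the C*-identity applied
    twice. *)
Lemma rnorm_cube a : cstar a = a -> rnorm (cmul a (cmul a a)) = rnorm a ^+ 3.
Proof.
move=> sa; have sq (b : A) : cstar b = b -> rnorm (cmul b b) = rnorm b ^+ 2.
  by move=> sb; rewrite -{1}sb rnorm_starM.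
have up : rnorm (cmul a (cmul a a)) <= rnorm a ^+ 3.
  by apply: le_trans (rnormM _ _) _; rewrite sq // -exprS.
apply/le_anti; rewrite up /=; have [a0|a0] := leP (rnorm a) 0.
  by rewrite (rnorm_le0 a0) cmul0l !rnorm0 expr0n.
rewrite -(ler_pM2r a0) -exprSr.
have -> : rnorm a ^+ 4 = rnorm (cmul (cmul a (cmul a a)) a).
  by rewrite -[4%N]/(2 * 2)%N exprM -!sq ?cstarM ?sa // !cmulA.
exact: rnormM.
Qed.

End CStarNorm.

Section HilbertModuleNorm.
Context {R : realType} {A : cstarAlgType R} {X : hilbertModType A}.
Implicit Types (a b : A) (c : R[i]) (x y z : X).

Lemma mact0r x : mact x (0 : A) = 0.
Proof. by rewrite -(scale0r (0 : A)) mactZr !scale0r. Qed.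

Lemma mact0l a : mact (0 : X) a = 0.
Proof. by rewrite -(scale0r (0 : X)) mactZl !scale0r. Qed.

Lemma mactNr x a : mact x (- a) = - mact x a.
Proof. by rewrite -scaleN1r mactZr scaleN1r. Qed.

Lemma mactNl x a : mact (- x) a = - mact x a.
Proof. by rewrite -scaleN1r mactZl scaleN1r. Qed.

Lemma mactBr x a b : mact x (a - b) = mact x a - mact x b.
Proof. by rewrite mactDr mactNr. Qed.

Lemma mactBl x y a : mact (x - y) a = mact x a - mact y a.
Proof. by rewrite mactDl mactNl. Qed.

Lemma mact_sumr (I : Type) (s : seq I) (F : I -> A) x :
  mact x (\sum_(i <- s) F i) = \sum_(i <- s) mact x (F i).
Proof. by elim/big_rec2: _ => [|i a b _ <-]; rewrite ?mact0r ?mactDr. Qed.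

Lemma mip0r x : mip x (0 : X) = 0.
Proof. by rewrite -(scale0r (0 : X)) mipZr !scale0r. Qed.

Lemma mip0l x : mip (0 : X) x = 0.
Proof. by rewrite -mip_star mip0r cstar0. Qed.

Lemma mipNr x y : mip x (- y) = - mip x y.
Proof. by rewrite -scaleN1r mipZr scaleN1r. Qed.

Lemma mipDl x y z : mip (x + y) z = mip x z + mip y z.
Proof. by rewrite -mip_star mipDr cstarD !mip_star. Qed.

Lemma mipZl c x y : mip (c *: x) y = c^* *: mip x y.
Proof. by rewrite -mip_star mipZr cstarZ mip_star. Qed.

Lemma mipNl x y : mip (- x) y = - mip x y.
Proof. by rewrite -mip_star mipNr cstarN mip_star. Qed.

Lemma mipBr x y z : mip x (y - z) = mip x y - mip x z.
Proof. by rewrite mipDr mipNr. Qed.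

Lemma mipMl x y a : mip (mact x a) y = cmul (cstar a) (mip x y).
Proof. by rewrite -mip_star mipMr cstarM mip_star. Qed.

Lemma rnorm_mip x : rnorm (mip x x) = rnorm x ^+ 2.
Proof. by apply: complexI; rewrite rmorphXn /= -!normE mip_norm. Qed.

Lemma rnorm_mact x a : rnorm (mact x a) <= rnorm x * rnorm a.
Proof.
rewrite -ler_sqr ?nnegrE ?mulr_ge0 ?rnorm_ge0 // -rnorm_mip mipMl mipMr exprMn.
apply: le_trans (rnormM _ _) _; rewrite rnorm_cstar.
have := ler_wpM2l (rnorm_ge0 a) (rnormM (mip x x) a).
by rewrite rnorm_mip; have := rnorm_ge0 a; nra.
Qed.

(** With a = <x,x>, one has <x.a,x.a> = a^3, to which [rnorm_cube] applies. *)
Lemma rnorm_mact_mip x : rnorm (mact x (mip x x)) = rnorm x ^+ 3.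
Proof.
apply/eqP; rewrite -(@eqrXn2 _ 2) ?exprn_ge0 ?rnorm_ge0 //.
by rewrite -rnorm_mip mipMl mipMr mip_star rnorm_cube ?mip_star // rnorm_mip exprAC.
Qed.

End HilbertModuleNorm.

Lemma imaginary_conj (R : realType) : ('i%C)^* = - 'i%C :> R[i].
Proof. by rewrite /= -[LHS]/(conjc _); simpc. Qed.

Lemma Im_eq0_conj (R : realType) (z : R[i]) : complex.Im z = 0 -> z^* = z.
Proof. by case: z => p q /= ->; rewrite -[LHS]/(conjc _) /= oppr0. Qed.

(* The modules below are Hilbert spaces for a scalar product f which induces
   the norm of the module, but which is not assumed to be related in any way to
   the A-valued inner product. *)
Section ScalarProduct.
Context {R : realType} {A : cstarAlgType R} {X : hilbertModType A}.
Context {f : X -> X -> R[i]} (ipf : inner_product f).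
Implicit Types (a b : A) (c : R[i]) (x y z w : X).

Let ii : 'i%C * 'i%C = -1 :> R[i].
Proof. by rewrite -expr2 sqr_i. Qed.

(** The parallelogram law enters here: the sum in question is half of <x+w,x+w> - <x-w,x-w>, whose
    norm is at most |x+w|^2 + |x-w|^2. *)
Lemma rnorm_mip_sym x w : rnorm (mip x w + mip w x) <= rnorm x ^+ 2 + rnorm w ^+ 2.
Proof.
have e : mip (x + w) (x + w) - mip (x - w) (x - w) = 2%:C *: (mip x w + mip w x).
  have -> : mip (x + w) (x + w) = mip x x + mip w w + (mip x w + mip w x).
    by rewrite mipDl !mipDr [mip w x + _]addrC addrACA.
  have -> : mip (x - w) (x - w) = mip x x + mip w w - (mip x w + mip w x).
    by rewrite mipDl !mipBr !mipNl opprK [- _ + mip w w]addrC addrACA -opprD.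
  by rewrite opprB addrC subrKA rmorphD rmorph1 scalerDl scale1r.
have := rnormD (mip (x + w) (x + w)) (- mip (x - w) (x - w)).
rewrite e rnormZr rnormN !rnorm_mip gtr0_norm // (parallelogram ipf).
by rewrite ler_pM2l.
Qed.

Lemma rnorm_mip_le x y : rnorm (mip x y) <= rnorm x * rnorm y.
Proof.
have [y0|y0] := leP (rnorm y) 0.
  by rewrite (rnorm_le0 y0) mip0r !rnorm0 mulr0.
set s := mip x y; pose t := (rnorm y ^+ 2)^-1.
have t0 : 0 < t by rewrite invr_gt0 exprn_gt0.
have ty : t * rnorm y ^+ 2 = 1 by rewrite mulVf // gt_eqF ?exprn_gt0.
(* For this w, <x,w> and <w,x> both equal ss^*/|y|^2, while |w|^2 <= |s|^2/|y|^2; [rnorm_mip_sym]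
   then reads 2|s|^2/|y|^2 <= |x|^2 + |s|^2/|y|^2. *)
pose w := t%:C *: mact y (cstar s).
have xw : mip x w = t%:C *: cmul s (cstar s) by rewrite mipZr mipMr.
have wx : mip w x = t%:C *: cmul s (cstar s).
  by rewrite mipZl mipMl cstarK conjCR -mip_star.
have := rnorm_mip_sym x w.
rewrite xw wx -scalerDl -rmorphD rnormZr rnorm_Mstar gtr0_norm ?addr_gt0 // => h.
have : rnorm w ^+ 2 <= t * rnorm s ^+ 2.
  have : rnorm w <= t * (rnorm y * rnorm s).
    rewrite rnormZr gtr0_norm // ler_pM2l //.
    by rewrite -[rnorm s]rnorm_cstar; apply: rnorm_mact.
  move=> ws; apply: (@le_trans _ _ ((t * (rnorm y * rnorm s)) ^+ 2)).
    by rewrite ler_sqr ?nnegrE ?rnorm_ge0 // !mulr_ge0 ?rnorm_ge0 // ltW.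
  by rewrite exprMn exprMn [t ^+ 2]expr2 mulrA -(mulrA t) ty mulr1.
move=> /(lerD (lexx (rnorm x ^+ 2)))/(le_trans h) {h}.
rewrite mulrDl lerD2r => h.
rewrite -ler_sqr ?nnegrE ?mulr_ge0 ?rnorm_ge0 // exprMn.
have := ler_wpM2r (sqr_ge0 (rnorm y)) h.
by rewrite mulrAC ty mul1r.
Qed.

(* With z = y(1 + ita) and theta_z w = z<z,w> one has |theta_z z| = |z|^3,
   while theta_z w = y(<y,w> + t^2 a^2 <y,w>) for every w. *)
Lemma rnorm_mact_unitary_deriv y a (t : R) : cstar a = a ->
  rnorm (y + (t%:C * 'i%C) *: mact y a) ^+ 2 <=
  rnorm y ^+ 2 * (1 + t ^+ 2 * rnorm a ^+ 2).
Proof.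
move=> sa; set z := y + _; set k := t%:C * 'i%C.
have kJ : k^* = - k by rewrite rmorphM /= conjCR imaginary_conj mulrN.
have kk : k * k = - (t ^+ 2)%:C.
  by rewrite mulrACA ii mulrN1 rmorphXn.
pose b := mip y z.
have bz : mip z z = b - k *: cmul a b.
  by rewrite {1}/z mipDl mipZl mipMl sa -/k kJ scaleNr.
have zzz : mact z (mip z z) = mact y (b + (t ^+ 2)%:C *: cmul a (cmul a b)).
  rewrite bz {1}/z -/k mactDl !mactBr !mactZr mactZl mactDr mactZr mactZl.
  by rewrite -!mactA scalerA kk scaleNr opprK addrA subrK.
have [z0|z0] := leP (rnorm z) 0.
  rewrite (rnorm_le0 z0) rnorm0 expr0n /=; apply: mulr_ge0; first exact: sqr_ge0.
  by rewrite addr_ge0 // mulr_ge0 // sqr_ge0.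
(* Multiplied by |z|, the left side becomes |z|^3 = |z<z,z>|; on the right, |<y,z>| <= |y||z| gives
   the factor |z| back. *)
rewrite -(ler_pM2r z0) -exprSr -rnorm_mact_mip zzz.
have q0 : 0 <= 1 + t ^+ 2 * rnorm a ^+ 2 by rewrite addr_ge0 // mulr_ge0 // sqr_ge0.
have h1 : rnorm (b + (t ^+ 2)%:C *: cmul a (cmul a b)) <=
          (1 + t ^+ 2 * rnorm a ^+ 2) * rnorm b.
  apply: le_trans (rnormD _ _) _; rewrite mulrDl mul1r lerD2l rnormZr.
  rewrite ger0_norm ?sqr_ge0 // -mulrA ler_wpM2l ?sqr_ge0 // expr2 -mulrA.
  apply: le_trans (rnormM _ _) _; rewrite ler_wpM2l ?rnorm_ge0 //.
  exact: rnormM.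
have h2 : rnorm b <= rnorm y * rnorm z := rnorm_mip_le y z.
apply: le_trans (rnorm_mact _ _) _.
apply: le_trans (ler_wpM2l (rnorm_ge0 y) h1) _.
have := ler_wpM2l (mulr_ge0 (rnorm_ge0 y) q0) h2.
by move: (rnorm y) (rnorm z) (rnorm b) (1 + _) => p q r s; nra.
Qed.

(** The bound above has no term linear in t, whence Re (x|ix.a) = 0: the sesquilinear defect [g]
    vanishes on the diagonal, and so everywhere by complex polarization. *)
Lemma ip_mact_selfadjoint a y z : cstar a = a -> f (mact y a) z = f y (mact z a).
Proof.
move=> sa; pose g y z := f (mact y a) z - f y (mact z a).
have gd x : g x x = 0.
  have : complex.Re (f x ('i%C *: mact x a)) = 0.
    apply: (@eq0_of_quadratic_le _ _ (rnorm x ^+ 2 * rnorm a ^+ 2)) => [|t].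
      by rewrite mulr_ge0 ?sqr_ge0.
    have := rnorm_mact_unitary_deriv x t sa.
    rewrite -scalerA (rnorm_sqD ipf) (ipZrR ipf) ReMr.
    have := sqr_ge0 (rnorm (t%:C *: 'i%C *: mact x a)).
    by nra.
  rewrite (ipZr ipf) imaginary_conj /g -(ip_conj ipf x) => h.
  rewrite Im_eq0_conj ?subrr // -h.
  by case: (f x _) => p q /=; rewrite oppr0 mul0r sub0r mulN1r opprK.
have gDl x x' w : g (x + x') w = g x w + g x' w.
  by rewrite /g mactDl !(ipDl ipf); ring.
have gDr x x' w : g w (x + x') = g w x + g w x'.
  by rewrite /g mactDl !(ipDr ipf); ring.
have gZl c x w : g (c *: x) w = c * g x w.
  by rewrite /g mactZl !(ipZl ipf); ring.
have gZr c x w : g w (c *: x) = c^* * g w x.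
  by rewrite /g mactZl !(ipZr ipf); ring.
have e1 x w : g x w + g w x = 0.
  by have := gd (x + w); rewrite gDl !gDr !gd addr0 add0r.
(* [g] is antisymmetric by [e1]; replacing z by iz makes it symmetric too. *)
have := e1 y ('i%C *: z); rewrite gZr gZl imaginary_conj mulNr.
move/eqP; rewrite addrC subr_eq0 => /eqP/mulfI gyz.
have g0 : g y z = 0.
  have := e1 y z; rewrite gyz; last by rewrite complexiE neq0Ci.
  by move/eqP; rewrite -mulr2n mulrn_eq0 /= => /eqP.
by apply/eqP; rewrite -subr_eq0; apply/eqP.
Qed.

End ScalarProduct.

(** * Polarization and the triple product x<y,z> *)

Section SesquilinearPolarization.
Context {R : realType} {V : lmodType R[i]}.

(* Only the part of G (x + c y) (x + c y) (x + c y) that is conjugate linear in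
   c involves G x y x alone. *)
Lemma trilinear_polarization (G : V -> V -> V -> R[i]) :
  (forall c x x' y z, G (c *: x + x') y z = c * G x y z + G x' y z) ->
  (forall c x y y' z, G x (c *: y + y') z = c^* * G x y z + G x y' z) ->
  (forall c x y z z', G x y (c *: z + z') = c * G x y z + G x y z') ->
  (forall x, G x x x = 0) -> forall x y z, G x y z + G z y x = 0.
Proof.
move=> G1 G2 G3 Gd.
have lin0 (h : V -> R[i]) (k : R[i] -> R[i]) : k 1 = 1 ->
    (forall c x y, h (c *: x + y) = k c * h x + h y) -> h 0 = 0.
  move=> k1 hl; have := hl 1 0 0; rewrite scale1r addr0 k1 mul1r => /eqP.
  by rewrite -subr_eq0 opprD addrA subrr sub0r oppr_eq0 => /eqP.
have D1 x x' y z : G (x + x') y z = G x y z + G x' y z.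
  by rewrite -{1}[x]scale1r G1 mul1r.
have D2 x x' y z : G y (x + x') z = G y x z + G y x' z.
  by rewrite -{1}[x]scale1r G2 conjC1 mul1r.
have D3 x x' y z : G y z (x + x') = G y z x + G y z x'.
  by rewrite -{1}[x]scale1r G3 mul1r.
have Z1 c x y z : G (c *: x) y z = c * G x y z.
  by rewrite -[c *: x]addr0 G1 (lin0 (fun x => G x y z) id) ?addr0 //.
have Z2 c x y z : G x (c *: y) z = c^* * G x y z.
  by rewrite -[c *: y]addr0 G2 (lin0 (fun y => G x y z) Num.conj) ?addr0 ?conjC1 //.
have Z3 c x y z : G x y (c *: z) = c * G x y z.
  by rewrite -[c *: z]addr0 G3 (lin0 (fun z => G x y z) id) ?addr0 //.
have half (z : R[i]) : z + z = 0 -> z = 0.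
  by move/eqP; rewrite -mulr2n mulrn_eq0 /= => /eqP.
(* Subtracting the values at x + y and x - y leaves twice the terms odd in y: those with a single y,
   and G y y y. *)
have P x y : G x x y + G x y x + G y x x = 0.
  apply: half; pose u := x + y; pose v := x + (-1) *: y.
  transitivity (G u u u - G v v v - 2 * G y y y).
    by rewrite /u /v !(D1, D2, D3) !(Z1, Z2, Z3) rmorphN1; ring.
  by rewrite !Gd mulr0 !subrr.
have M x y : G x y x = 0.
  have := P x ('i%C *: y); rewrite Z1 Z2 Z3 imaginary_conj => e.
  have : 'i%C * (G x x y + G x y x + G y x x) -
         ('i%C * G x x y + - 'i%C * G x y x + 'i%C * G y x x) = 0.
    by rewrite P e mulr0 subr0.
  set g := G x y x => h; have {}h : 'i%C * (g + g) = 0 by rewrite -h; ring.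
  move/eqP: h; rewrite mulf_eq0 -[_ == 0]/('i%C == 0 :> R[i]) complexiE.
  by rewrite (negPf (neq0Ci _)) => /eqP/half.
move=> x y z; have := M (x + z) y.
by rewrite !(D1, D3) !M add0r addr0 addrC.
Qed.

End SesquilinearPolarization.

Section TripleProduct.
Context {R : realType} {A : cstarAlgType R} {X : hilbertModType A}.
Context {f : X -> X -> R[i]} (ipf : inner_product f).
Implicit Types (a b : A) (c : R[i]) (x y z w : X).

Lemma ip_mact a y z : f (mact y a) z = f y (mact z (cstar a)).
Proof.
have h1 : cstar (a + cstar a) = a + cstar a by rewrite cstarD cstarK addrC.
have h2 : cstar ('i%C *: (a - cstar a)) = 'i%C *: (a - cstar a).
  by rewrite cstarZ imaginary_conj cstarD cstarN cstarK scaleNr -scalerN opprB.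
have := ip_mact_selfadjoint ipf y z h1; have := ip_mact_selfadjoint ipf y z h2.
rewrite !mactZr !(mactDr, mactNr) (ipZl ipf) (ipZr ipf) imaginary_conj.
rewrite !(ipDl ipf, ipDr ipf, ipNl ipf, ipNr ipf).
rewrite mulNr -mulrN; have i0 : 'i%C != 0 :> R[i] by rewrite complexiE neq0Ci.
move=> /(mulfI i0) e1 e2; apply: (@mulIf _ 2); first by rewrite pnatr_eq0.
move: (f (mact y a) z) (f (mact y (cstar a)) z) e1 e2 => p q e1 e2.
have -> : p * 2 = (p - q) + (p + q) by ring.
by rewrite e1 e2; ring.
Qed.

(** Write a = <x,x> and n = |x|. Then (x.aa|x) = |x.a|^2 = n^6 while |x.aa| <= n^5: equality in
    Cauchy-Schwarz, so x.aa = n^4 x. Hence u = x.a - n^2 x satisfies u.a = -n^2 u, but a = b^*b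
    makes (u.a|u) = |u.b^*|^2 nonnegative. *)
Lemma mact_mip_self x : mact x (mip x x) = (rnorm x ^+ 2)%:C *: x.
Proof.
set a := mip x x; have sa : cstar a = a by apply: mip_star.
set n := rnorm x; have n0 : 0 <= n by apply: rnorm_ge0.
have na : rnorm a = n ^+ 2 by apply: rnorm_mip.
have nxa : rnorm (mact x a) = n ^+ 3 by apply: rnorm_mact_mip.
have nxaa : rnorm (mact (mact x a) a) <= n ^+ 5.
  by apply: le_trans (rnorm_mact _ _) _; rewrite nxa na -exprD.
have e1 : mact (mact x a) a = (n ^+ 4)%:C *: x.
  apply/eqP; rewrite -subr_eq0; apply/eqP/rnorm0_eq0/eqP.
  rewrite -sqrf_eq0; apply/eqP/le_anti; rewrite sqr_ge0 andbT.
  rewrite (rnorm_sqB ipf) rnormZr (ipZrR ipf) ReMr ip_mact sa -(rnorm_sqE ipf).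
  rewrite nxa -/n ger0_norm ?exprn_ge0 //.
  have : rnorm (mact (mact x a) a) ^+ 2 <= n ^+ 10.
    by rewrite -[10%N]/(5 * 2)%N exprM ler_sqr ?nnegrE ?rnorm_ge0 ?exprn_ge0.
  by move: (rnorm _ ^+ 2) => r; lra.
set u := mact x a - (n ^+ 2)%:C *: x.
have ua : mact u a = - ((n ^+ 2)%:C *: u).
  by rewrite mactBl mactZl e1 scalerBr scalerA -rmorphM -exprD opprB.
have [b ab] := mip_ge0 x; rewrite -/a in ab.
have := sqr_ge0 (rnorm (mact u (cstar b))).
have -> : rnorm (mact u (cstar b)) ^+ 2 = - (n ^+ 2 * rnorm u ^+ 2).
  rewrite (rnorm_sqE ipf) -ip_mact -mactA -ab ua (ipNl ipf) (ipZl ipf) ReN ReMr.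
  by rewrite -(rnorm_sqE ipf).
rewrite oppr_ge0 => h.
have : n ^+ 2 * rnorm u ^+ 2 == 0.
  by rewrite eq_le h mulr_ge0 ?sqr_ge0.
rewrite mulf_eq0 !sqrf_eq0 => /orP[/eqP/rnorm0_eq0 x0|/eqP/rnorm0_eq0/eqP].
  by rewrite x0 mact0l scaler0.
by rewrite subr_eq0 => /eqP.
Qed.

Lemma mact_mip_sym x y z :
  mact x (mip y z) + mact z (mip y x) = f x y *: z + f z y *: x.
Proof.
apply: (ip_inj ipf) => w; rewrite !(ipDl ipf) !(ipZl ipf).
pose G x y z := f (mact x (mip y z)) w - f x y * f z w.
have G0 := @trilinear_polarization _ _ G.
apply/eqP; rewrite -subr_eq0; apply/eqP.
rewrite opprD addrACA; apply: G0 => [c x1 x2 y1 z1|c x1 y1 y2 z1|c x1 y1 z1 z2|x1].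
- by rewrite /G mactDl mactZl !(ipDl ipf, ipZl ipf); ring.
- by rewrite /G mipDl mipZl mactDr mactZr !(ipDl ipf, ipZl ipf, ipDr ipf, ipZr ipf); ring.
- by rewrite /G mipDr mipZr mactDr mactZr !(ipDl ipf, ipZl ipf); ring.
- by rewrite /G mact_mip_self (ipZl ipf) (ip_norm ipf) subrr.
Qed.

Lemma mact_mip_sandwich x y : mact x (mip y x) = f x y *: x.
Proof.
have := mact_mip_sym x y x.
move: (mact _ _) (f x y *: x) => u v e.
have : 2%:C *: u = 2%:C *: v by rewrite rmorphD !scalerDl !scale1r.
by apply: scalerI; rewrite rmorphD -mulr2n mulrn_eq0 oner_eq0.
Qed.

(* By mact_mip_sym, the left and right Peirce projections L = e<e,.> and
   R = .<e,e> satisfy L + R = 1 + (.|e)e. *)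
Lemma peirce_dichotomy e : rnorm e = 1 ->
  (forall y, mact e (mip e y) = y) \/ (forall y, mact y (mip e e) = y).
Proof.
move=> e1; set p := mip e e.
have ep : mact e p = e by rewrite mact_mip_self e1 expr1n scale1r.
have pp : cmul p p = p by rewrite {1}/p -mipMr ep.
have ps : cstar p = p by apply: mip_star.
pose L y := mact e (mip e y).
have LR y : L y + mact y p = y + f y e *: e.
  by rewrite mact_mip_sym (ip_norm ipf) e1 expr1n scale1r.
have LD x y : L (x + y) = L x + L y by rewrite /L mipDr mactDr.
have LZ c x : L (c *: x) = c *: L x by rewrite /L mipZr mactZr.
have Le : L e = e by [].
have LL y : L (L y) = L y by rewrite /L mipMr mactA ep.
have [|/existsNP[u' Lu']] := pselect (forall y, L y = y); first by left.
right=> v'; apply: contrapT => Rv'.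
have e0 : e != 0.
  by apply/eqP => e0; move/eqP: e1; rewrite e0 rnorm0 eq_sym oner_eq0.
have efree (y : X) (c : R[i]) : y = y + c *: e -> c = 0.
  rewrite -{1}[y]addr0 => /addrI/esym/eqP.
  by rewrite scaler_eq0 (negPf e0) orbF => /eqP.
(* If neither projection is the identity, there are nonzero v, u with L v = 0, v.p = v and L u = u,
   u.p = 0. The contradiction is that v<e,u><u,e> is 0 by its first product, and |u|^2 v because
   u<u,e> = |u|^2 e. *)
pose v := u' - L u'.
have v0 : v != 0 by rewrite subr_eq0; apply/eqP => /esym.
have Lv : L v = 0 by rewrite /v LD -scaleN1r LZ LL scaleN1r subrr.
have Rv : mact v p = v.
  have := LR v; rewrite Lv add0r => Rv.
  have : mact (mact v p) p = mact v p by rewrite -mactA pp.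
  rewrite {1}Rv mactDl mactZl ep => /esym/efree fve.
  by rewrite Rv fve scale0r addr0.
have ev : mip e v = 0.
  by rewrite -{1}ep mipMl ps {1}/p -mipMr -/(L v) Lv mip0r.
pose u := v' - mact v' p.
have u0 : u != 0 by rewrite subr_eq0; apply/eqP => /esym.
have Ru : mact u p = 0 by rewrite mactBl -mactA pp subrr.
have Lu : L u = u.
  have := LR u; rewrite Ru addr0 => Lu.
  have := LL u; rewrite {1}Lu LD LZ Le => /esym/efree fue.
  by rewrite Lu fue scale0r addr0.
have fve : f v e = 0.
  by have := LR v; rewrite Lv add0r Rv => /efree.
have fue : f u e = 0.
  by have := LR u; rewrite Ru addr0 Lu => /efree.
have veu : mact v (mip e u) = 0.
  by have := mact_mip_sym v e u; rewrite ev mact0r addr0 fve fue !scale0r addr0.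
have uue : mact u (mip u e) = (rnorm u ^+ 2)%:C *: e.
  have euu : mact e (mip u u) = 0.
    by rewrite -{1}ep -mactA -ps -mipMl Ru mip0l mact0r.
  have feu : f e u = 0 by rewrite -(ip_conj ipf) fue conjC0.
  by have := mact_mip_sym u u e; rewrite euu addr0 (ip_norm ipf) feu scale0r addr0.
have := congr1 (mact^~ (mip u e)) veu.
rewrite /= -mactA -mipMr uue mipZr mactZr Rv mact0l => /eqP.
rewrite scaler_eq0 (negPf v0) orbF => /eqP/complexI/eqP.
by rewrite sqrf_eq0 => /eqP/rnorm0_eq0/eqP; rewrite (negPf u0).
Qed.

(** The alternative at one unit vector e spreads to X by writing vectors as e<e,z> in the row case
    and as y<e,e> in the column case; the sandwich x<y,x> = (x|y)x evaluates what remains. *)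
Lemma row_or_column :
  (forall x y z, mact x (mip y z) = f x y *: z) \/
  (exists e : X, [/\ rnorm e = 1, forall y, mact y (mip e e) = y
     & forall y z, mip y z = f z y *: mip e e]).
Proof.
have [X0|/existsNP[x /eqP x0]] := pselect (forall x : X, x = 0).
  (* The zero module has no unit vector and goes with the rows; fullness then makes [A] zero, which
     is K(0). *)
  by left=> x y z; rewrite (X0 (mact _ _)) (X0 z) scaler0.
have nx : 0 < rnorm x.
  by rewrite lt_def rnorm_ge0 andbT; apply: contra_neq x0 => /rnorm0_eq0.
have [e e1] : exists e : X, rnorm e = 1.
  exists ((rnorm x)^-1%:C *: x).
  by rewrite rnormZr gtr0_norm ?invr_gt0 // mulVf // gt_eqF.
have [Le|Re] := peirce_dichotomy e1; [left|right].
  have ey z y : mact z (mip y e) = f z y *: e.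
    have eyz : mact e (mip y z) = f e y *: z.
      by rewrite -{1}(Le y) mipMl mip_star mactA mact_mip_sandwich mactZl Le.
    have := mact_mip_sym z y e; rewrite eyz addrC => /eqP.
    by rewrite [in X in _ == X]addrC (inj_eq (addrI _)) => /eqP.
  by move=> x1 y z; rewrite -{1}(Le z) mipMr mactA ey mactZl Le.
exists e; split=> // y z.
have zye w : mact w (mip y e) = f e y *: w.
  by rewrite -{1}(Re w) -mactA -mipMr mact_mip_sandwich mipZr mactZr Re.
have eyz : mact e (mip y z) = f z y *: e.
  have := mact_mip_sym e y z; rewrite zye addrC => /eqP.
  by rewrite (inj_eq (addrI _)) => /eqP.
by rewrite -{1}(Re y) mipMl mip_star -mipMr eyz mipZr.
Qed.

End TripleProduct.
(** * Column modules *)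

Section CornerNorm.
Context {R : realType} {A : cstarAlgType R} {X : hilbertModType A}.

(** A matrix over the upper right corner reads only the A-components of a vector and returns only
    X-components. *)
Lemma mod_mxnormE n (x : 'M[X]_n) :
  mod_mxnorm x = ereal_sup [set (Num.sqrt (rnorm (\sum_i
     mip (\sum_j mact (x i j) (w j).2) (\sum_j mact (x i j) (w j).2))))%:E
     | w in [set w : 'I_n -> X * A | xa_norm w <= 1]].
Proof.
rewrite /mod_mxnorm /lk_mxnorm /opnorm; congr ereal_sup.
apply: eq_imagel => w _; congr (_%:E); rewrite /xa_norm; congr Num.sqrt.
congr rnorm; apply: eq_bigr => i _.
have -> : mxop (map_mx lk_act (map_mx lk_corner x)) w i =
          (\sum_j mact (x i j) (w j).2, 0).
  rewrite /mxop [LHS]surjective_pairing !raddf_sum /=; congr pair.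
    by apply: eq_bigr => j _; rewrite !mxE /= add0r.
  by rewrite big1 // => j _; rewrite !mxE /= mip0l cmul0l addr0.
by rewrite /= cmul0r addr0.
Qed.

End CornerNorm.

Section Column.
Context {R : realType} {H : hilbertType R} {A : cstarAlgType R}.
Context {X : hilbertModType A} (U : {linear X -> H}) (e : X).
Hypothesis Xfull : full_module X.
Hypothesis Uiso : forall x, `|U x| = `|x|.
Hypothesis Usurj : forall h, exists x, U x = h.
Hypothesis e1 : rnorm e = 1.
Hypothesis Re : forall y : X, mact y (mip e e) = y.
Hypothesis mipE : forall y z : X, mip y z = hdot (U z) (U y) *: mip e e.

Let ipH := hdot_inner_product H.
Let p := mip e e.
(** The vector functional of e: contractive, inverse to c |-> c p, and available before [A] is known
    to be the line of p. *)
Let coef (a : A) := hdot (U (mact e a)) (U e).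

Let Unorm x : rnorm (U x) = rnorm x.
Proof. by rewrite /rnorm Uiso. Qed.

Let np : rnorm p = 1.
Proof. by rewrite rnorm_mip e1 expr1n. Qed.

Let pp : cmul p p = p.
Proof. by rewrite {1}/p -mipMr Re. Qed.

Let ps : cstar p = p.
Proof. exact: mip_star. Qed.

Let coefL c a b : coef (c *: a + b) = c * coef a + coef b.
Proof. by rewrite /coef mactDr mactZr linearP (ip_linear ipH). Qed.

Let coefB a b : coef (a - b) = coef a - coef b.
Proof. by rewrite -scaleN1r addrC coefL mulN1r addrC. Qed.

Let coefp c : coef (c *: p) = c.
Proof.
rewrite /coef mactZr Re linearZ /= (ipZl ipH) (ip_norm ipH) Unorm e1 expr1n.
by rewrite mulr1.
Qed.

Let coef_le a : normc (coef a) <= rnorm a.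
Proof.
apply: le_trans (cauchy_schwarz ipH _ _) _; rewrite !Unorm e1 mulr1.
by apply: le_trans (rnorm_mact _ _) _; rewrite e1 mul1r.
Qed.

(** The map a |-> a - coef(a)p vanishes on the span of the inner products and has norm at most 2,
    hence the tolerance d/2 in the approximation. *)
Lemma column_algebra_line a : a = coef a *: p.
Proof.
apply/eqP; rewrite -subr_eq0; apply/eqP/rnorm0_eq0/le_anti.
rewrite rnorm_ge0 andbT; apply/ler_addgt0Pr => d d0; rewrite add0r.
have : closure (linear_span [set mip p.1 p.2 | p in [set: X * X]]) a.
  by rewrite Xfull.
move=> /closure_rnormP/(_ _ (divr_gt0 d0 (ltr0Sn _ 1)))[b [n [c [s [sP ->]]]] ab].
set b' := \sum_(i < n) _ in ab.
have bE : b' = coef b' *: p.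
  suff [k ->] : exists k, b' = k *: p by rewrite coefp.
  exists (\sum_(i < n) c i * coef (s i)); rewrite scaler_suml; apply: eq_bigr => i _.
  have [[y z] _ /= <-] := sP i.
  by rewrite -scalerA; congr (_ *: _); rewrite mipE coefp.
have -> : a - coef a *: p = (a - b') - coef (a - b') *: p.
  by rewrite coefB scalerBl -bE opprB addrA subrK.
apply: le_trans (rnormD _ _) _; rewrite rnormN rnormZ np mulr1.
by have := coef_le (a - b'); lra.
Qed.

Lemma column_star_isomorphic : star_isomorphic_C A.
Proof.
exists coef; split=> [|||a].
- exists (fun c => c *: p) => [a|c]; first by rewrite -column_algebra_line.
  exact: coefp.
- exact: coefL.
- move=> a b; rewrite [a in LHS]column_algebra_line [b in LHS]column_algebra_line.
  by rewrite cmulZl cmulZr pp scalerA coefp.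
- by rewrite [a in LHS]column_algebra_line cstarZ ps coefp.
Qed.

Let rnorm_sump n (r : 'I_n -> R) : (forall i, 0 <= r i) ->
  rnorm (\sum_i (r i)%:C *: p) = \sum_i r i.
Proof.
move=> r0; rewrite -scaler_suml -rmorph_sum /= rnormZr np mulr1.
by rewrite ger0_norm // sumr_ge0.
Qed.

Let mip_self (x : X) : mip x x = (rnorm x ^+ 2)%:C *: p.
Proof. by rewrite mipE (ip_norm ipH) Unorm. Qed.

Let xa_normE n (w : 'I_n -> X * A) : xa_norm w =
  Num.sqrt (\sum_i (rnorm (w i).1 ^+ 2 + normc (coef (w i).2) ^+ 2)).
Proof.
rewrite /xa_norm -rnorm_sump => [|i]; last by rewrite addr_ge0 ?sqr_ge0.
congr (Num.sqrt (rnorm _)); apply: eq_bigr => i _.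
rewrite mip_self rmorphD scalerDl; congr (_ + _).
rewrite {1 2}[(w i).2]column_algebra_line cstarZ ps cmulZl cmulZr pp scalerA.
by rewrite mulrC mulcJ.
Qed.

Lemma column_cisometric : cisometric_col X H.
Proof.
exists (fun x (c : R[i]^o) => c *: U x); split.
- by move=> c x y v; rewrite linearP scalerDr !scalerA mulrC.
- apply/seteqP; split=> [_ [x _ <-]|T [lT cT]].
    have lx : linear (fun c : R[i]^o => c *: U x).
      by move=> k a b; rewrite scalerDl scalerA.
    split=> //; apply/(linear_boundedP lx).
    exists (rnorm x + 1) => [|c]; first by rewrite ltr_wpDl ?rnorm_ge0.
    rewrite rnormZ Unorm rnorm_scalar mulrC ler_wpM2r ?normc_ge0 //.
    by rewrite lerDl.
  have [x Ux] := Usurj (T 1); exists x => //.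
  apply/funext => c; rewrite Ux.
  have T0 : T 0 = 0 by rewrite -[0 in LHS](addNr 0) -scaleN1r lT scaleN1r addNr.
  by rewrite -[c in RHS]mulr1 -[_ * _]addr0 lT T0 addr0.
- move=> n x; rewrite mod_mxnormE /ops_mxnorm /opnorm; congr ereal_sup.
  have val (w : 'I_n -> X * A) (v : 'I_n -> R[i]^o) :
      (forall j, (w j).2 = v j *: p) ->
      Num.sqrt (rnorm (\sum_i mip (\sum_j mact (x i j) (w j).2)
                                  (\sum_j mact (x i j) (w j).2))) =
      l2norm (mxop (map_mx (fun x (c : R[i]^o) => c *: U x) x) v).
    move=> wv; rewrite /l2norm; congr Num.sqrt.
    rewrite -rnorm_sump => [|i]; last exact: sqr_ge0.
    congr rnorm; apply: eq_bigr => i _; rewrite mip_self -Unorm.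
    congr ((rnorm _ ^+ 2)%:C *: _); rewrite raddf_sum /mxop.
    by apply: eq_bigr => j _; rewrite mxE wv mactZr Re; apply: linearZ.
  (* The suprema range over the same values: v is realized by the vectors (0, v_j p), and conversely
     dropping the X-components of w only decreases its norm. *)
  apply/seteqP; split=> [_ [v /= v1 <-]|_ [w /= w1 <-]].
    exists (fun j => (0, v j *: p)); last by rewrite (@val _ v).
    rewrite /= xa_normE; congr (_ <= 1): v1; congr Num.sqrt.
    by apply: eq_bigr => j _; rewrite /= rnorm0 coefp expr0n add0r rnorm_scalar.
  exists (fun j => coef (w j).2).
    move: w1; rewrite /= xa_normE; apply: le_trans; apply: ler_wsqrtr.
    apply: ler_sum => j _; rewrite rnorm_scalar lerDr; exact: sqr_ge0.
  by rewrite (@val w (fun j => coef (w j).2)) // => j; apply: column_algebra_line.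
Qed.

End Column.
(** * Row modules *)

(** Taking 2^k-th roots makes C disappear; Bernoulli's inequality for r/K > 1 does this without
    roots. *)
Lemma le_of_pow2_le (R : realType) (r K C : R) : 0 < K -> 0 <= r ->
  (forall k, r ^+ (2 ^ k) <= C * K ^+ (2 ^ k)) -> r <= K.
Proof.
move=> K0 r0 rK; rewrite leNgt; apply/negP => Kr.
pose d := r / K - 1; have d0 : 0 < d by rewrite subr_gt0 ltr_pdivlMr // mul1r.
have bern m : 1 + m%:R * d <= (r / K) ^+ m.
  elim: m => [|m IHm]; first by rewrite expr0 mul0r addr0.
  have -> : r / K = 1 + d by rewrite addrC subrK.
  rewrite exprS -natr1; move: IHm; have -> : r / K = 1 + d by rewrite addrC subrK.
  have : 0 <= m%:R :> R by [].
  by move: (m%:R : R) ((1 + d) ^+ m) => n' q; nra.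
have := rK (Num.truncn (`|C| / d)).+1; set k := (Num.truncn _).+1.
rewrite -ler_pdivrMr ?exprn_gt0 // -expr_div_n.
move=> /(le_trans (bern _)) h.
have : `|C| < k%:R * d by rewrite -ltr_pdivrMr // truncnS_gt.
have : k%:R * d <= (2 ^ k)%N%:R * d.
  by rewrite ler_pM2r // ler_nat ltnW // ltn_expl.
by have := ler_norm C; lra.
Qed.

(** * The norm of [A] recovered from its right action *)

Section RightRegular.
Context {R : realType} {A : cstarAlgType R} {X : hilbertModType A}.
Context {f : X -> X -> R[i]} (ipf : inner_product f).
Hypothesis Xfull : full_module X.

Lemma full_approx a (d : R) : 0 < d ->
  exists n (c : 'I_n -> R[i]) (p : 'I_n -> X * X),
    rnorm (a - \sum_i c i *: mip (p i).1 (p i).2) < d.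
Proof.
move=> d0; have : closure (linear_span [set mip p.1 p.2 | p in [set: X * X]]) a.
  by rewrite Xfull.
move=> /closure_rnormP/(_ _ d0)[b [n [c [s [sP ->]]]] ab].
have /choice[p pP] (i : 'I_n) : exists p : X * X, mip p.1 p.2 = s i.
  by have [p _ <-] := sP i; exists p.
exists n, c, p; congr (rnorm (a - _) < d): ab.
by apply: eq_bigr => i _; rewrite pP.
Qed.

(** Since <y,x>b^n = <y,x.b^n>, multiplying b^n on the left by a combination s of inner products
    costs at most a constant times K^n. With s within K/2 of b, this gives |b^n| <= C K^n by
    induction, and |b^(2^k)| = |b|^(2^k) removes C. *)
Lemma rnorm_le_selfadjoint b (K : R) : 0 < K -> cstar b = b ->
  (forall x : X, rnorm (mact x b) <= K * rnorm x) -> rnorm b <= K.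
Proof.
(* [pw n] is b^(n+1): a zeroth power would call for a unit. *)
move=> K0 sb xb; pose pw n := iter n (cmul b) b.
have pwS n : pw n.+1 = cmul b (pw n) by [].
have pwM m n : cmul (pw m) (pw n) = pw (m + n).+1.
  by elim: m => [|m IHm] //; rewrite pwS -cmulA IHm.
have pwC n : cmul (pw n) b = cmul b (pw n).
  by rewrite -[b in LHS]/(pw 0%N) pwM addn0.
have spw n : cstar (pw n) = pw n.
  by elim: n => [|n IHn] //; rewrite pwS cstarM IHn sb pwC.
have xpw n (x : X) : rnorm (mact x (pw n)) <= K ^+ n.+1 * rnorm x.
  elim: n x => [|n IHn] x; first exact: xb.
  rewrite pwS mactA; apply: le_trans (IHn _) _.
  by rewrite [K ^+ n.+2]exprSr -mulrA ler_pM2l ?exprn_gt0.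
have [n0 [c [p bs]]] := full_approx b (divr_gt0 K0 (ltr0Sn _ 1)).
set s := \sum_i _ in bs.
pose Cs := \sum_i normc (c i) * (rnorm (p i).1 * rnorm (p i).2).
have spwn n : rnorm (cmul s (pw n)) <= Cs * K ^+ n.+1.
  rewrite /s cmul_suml; apply: le_trans (rnorm_sum _ _) _.
  rewrite mulr_suml; apply: ler_sum => i _.
  rewrite cmulZl rnormZ -mulrA ler_wpM2l ?normc_ge0 // -mipMr.
  apply: le_trans (rnorm_mip_le ipf _ _) _.
  by rewrite -mulrA ler_wpM2l ?rnorm_ge0 // mulrC.
have Cs0 : 0 <= Cs.
  by apply: sumr_ge0 => i _; rewrite !mulr_ge0 ?normc_ge0 ?rnorm_ge0.
(* The first term covers n = 0; the second absorbs Cs in |b^(n+2)| <= (K/2)|b^(n+1)| + Cs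
   K^(n+1). *)
pose C := rnorm b / K + 2 * Cs / K.
have pwC0 n : rnorm (pw n) <= C * K ^+ n.+1.
  elim: n => [|n IHn].
    rewrite expr1 mulrDl divfK ?gt_eqF //= lerDl.
    by rewrite !mulr_ge0 ?invr_ge0 // ltW.
  have -> : pw n.+1 = cmul (b - s) (pw n) + cmul s (pw n).
    by rewrite cmulBl subrK.
  apply: le_trans (rnormD _ _) _; apply: le_trans (lerD (rnormM _ _) (spwn n)) _.
  have := ler_pM (rnorm_ge0 _) (rnorm_ge0 _) (ltW bs) IHn.
  move=> h; apply: le_trans (lerD h (lexx _)) _.
  have -> : C * K ^+ n.+2 = K / 2 * (C * K ^+ n.+1) + Cs * K ^+ n.+1
                          + rnorm b / 2 * K ^+ n.+1.
    by rewrite [K ^+ n.+2]exprS /C; field; rewrite gt_eqF.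
  by rewrite lerDl !mulr_ge0 ?rnorm_ge0 ?exprn_ge0 ?invr_ge0 // ltW.
have pw2 k n : rnorm (pw n) ^+ (2 ^ k) <= C * K ^+ (n.+1 * 2 ^ k).
  elim: k n => [|k IHk] n; first by rewrite expn0 muln1 expr1.
  rewrite expnS exprM -rnorm_starM spw pwM; apply: le_trans (IHk _) _.
  by rewrite -addSn -addnS addnn -muln2 -mulnA.
apply: (@le_of_pow2_le _ _ _ C) => // [|k]; first exact: rnorm_ge0.
by have := pw2 k 0%N; rewrite mul1n.
Qed.

(** The actions of a and a^* are adjoint for [f], so both are bounded by K and that of aa^* by K^2;
    the C*-identity reduces the claim to aa^*. *)
Lemma rnorm_le_right_regular a (K : R) : 0 < K ->
  (forall x : X, rnorm (mact x a) <= K * rnorm x) -> rnorm a <= K.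
Proof.
move=> K0 xa.
have xas (x : X) : rnorm (mact x (cstar a)) <= K * rnorm x.
  have [|p0] := leP (rnorm (mact x (cstar a))) 0.
    by move/le_trans; apply; rewrite mulr_ge0 ?rnorm_ge0 // ltW.
  rewrite -(ler_pM2r p0) -expr2 (rnorm_sqE ipf) -(ip_mact ipf).
  apply: le_trans (Re_cauchy_schwarz ipf _ _) _.
  have := ler_wpM2r (rnorm_ge0 x) (xa (mact x (cstar a))).
  by move/le_trans; apply; rewrite mulrAC.
rewrite -ler_sqr ?nnegrE ?rnorm_ge0 ?(ltW K0) // -rnorm_Mstar.
apply: rnorm_le_selfadjoint => [||x]; first exact: exprn_gt0.
  by rewrite cstarM cstarK.
rewrite mactA; apply: le_trans (xas _) _.
by rewrite expr2 -mulrA ler_pM2l.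
Qed.

Lemma mact_faithful a b : (forall x : X, mact x a = mact x b) -> a = b.
Proof.
move=> ab; apply/eqP; rewrite -subr_eq0; apply/eqP/rnorm_le0/ler_addgt0Pr => e e0.
rewrite add0r; apply: rnorm_le_right_regular => // x.
by rewrite mactBr ab subrr rnorm0 mulr_ge0 ?rnorm_ge0 // ltW.
Qed.

End RightRegular.

(** * Row modules over the compact operators *)

Section Row.
Context {R : realType} {H : hilbertType R} {A : cstarAlgType R}.
Context {X : hilbertModType A} {f : X -> X -> R[i]} (ipf : inner_product f).
Context (W : X -> H) (V : H -> X).
Hypothesis Xfull : full_module X.
Hypothesis mact_mip : forall x y z : X, mact x (mip y z) = f x y *: z.
Hypothesis W_antilinear : forall c x y, W (c *: x + y) = c^* *: W x + W y.
Hypothesis W_dot : forall x y, hdot (W x) (W y) = f y x.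
Hypothesis WV : cancel V W.
Hypothesis VW : cancel W V.
Implicit Types (a b : A) (x y z u : X) (v : H).

Let ipH := hdot_inner_product H.

Let W0 : W 0 = 0.
Proof.
have := W_antilinear (-1) 0 0.
by rewrite scaler0 addr0 rmorphN1 scaleN1r addNr.
Qed.

Let WD x y : W (x + y) = W x + W y.
Proof. by rewrite -{1}[x]scale1r W_antilinear conjC1 scale1r. Qed.

Let WZ c x : W (c *: x) = c^* *: W x.
Proof. by rewrite -[c *: x]addr0 W_antilinear W0 addr0. Qed.

Let VL c v v' : V (c *: v + v') = c^* *: V v + V v'.
Proof. by rewrite -[RHS]VW W_antilinear conjCK !WV. Qed.

Let Wnorm x : rnorm (W x) = rnorm x.
Proof.
apply/eqP; rewrite -(@eqrXn2 _ 2) ?rnorm_ge0 //.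
by rewrite (rnorm_sqE ipH) W_dot (rnorm_sqE ipf).
Qed.

Let Vnorm v : rnorm (V v) = rnorm v.
Proof. by rewrite -{2}(WV v) Wnorm. Qed.

(* The right action of a^*, transported by the antiunitary W, is linear in v and
   multiplicative in a. *)
Let phi a v := W (mact (V v) (cstar a)).

Let phiL c a b v : phi (c *: a + b) v = c *: phi a v + phi b v.
Proof. by rewrite /phi cstarD cstarZ mactDr mactZr W_antilinear conjCK. Qed.

Let phiB a b v : phi (a - b) v = phi a v - phi b v.
Proof. by rewrite addrC -scaleN1r phiL scaleN1r addrC. Qed.

Let phi_linear a : linear (phi a).
Proof. by move=> c u v; rewrite /phi VL mactDl mactZl W_antilinear conjCK. Qed.

Let phi_sum n (F : 'I_n -> A) v : phi (\sum_i F i) v = \sum_i phi (F i) v.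
Proof.
have phi0 : phi 0 v = 0 by rewrite /phi cstar0 mact0r W0.
have phiD a b : phi (a + b) v = phi a v + phi b v.
  by rewrite -{1}[a]scale1r phiL scale1r.
by elim/big_rec2: _ => [|i a b _ <-].
Qed.

Let phi_mip x y v : phi (mip x y) v = hdot v (W y) *: W x.
Proof. by rewrite /phi mip_star mact_mip WZ (ip_conj ipf) -W_dot WV. Qed.

Let phi_le a v : rnorm (phi a v) <= rnorm a * rnorm v.
Proof.
rewrite /phi Wnorm; apply: le_trans (rnorm_mact _ _) _.
by rewrite rnorm_cstar Vnorm mulrC.
Qed.

Let rnorm_le_phi a (K : R) : 0 < K ->
  (forall v, rnorm (phi a v) <= K * rnorm v) -> rnorm a <= K.
Proof.
move=> K0 phiK; rewrite -rnorm_cstar.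
apply: (rnorm_le_right_regular ipf) => // x.
by have := phiK (W x); rewrite /phi VW !Wnorm.
Qed.

Let phi_finite_rank ps : exists b, forall v, phi b v = finite_rank (f := @hdot R H) ps v.
Proof.
elim: ps => [|p ps [b bP]].
  by exists 0 => v; rewrite /finite_rank big_nil /phi cstar0 mact0r W0.
exists (1 *: mip (V p.1) (V p.2) + b) => v.
by rewrite phiL bP phi_mip !WV scale1r /finite_rank big_cons.
Qed.

Let phi_approx a : approx_finite_rank (f := @hdot R H) (phi a).
Proof.
move=> e e0; have [n [c [p ap]]] := full_approx Xfull a e0.
exists [seq (c i *: W (p i).1, W (p i).2) | i <- enum 'I_n] => v.
have <- : phi (\sum_i c i *: mip (p i).1 (p i).2) v =
  finite_rank (f := @hdot R H) [seq (c i *: W (p i).1, W (p i).2) | i <- enum 'I_n] v.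
  rewrite phi_sum /finite_rank big_map big_enum /=; apply: eq_bigr => i _.
  rewrite -[_ *: mip _ _]addr0 phiL phi_mip /phi cstar0 mact0r W0 addr0.
  by rewrite !scalerA mulrC.
rewrite -phiB; apply: le_trans (phi_le _ _) _.
by apply: ler_wpM2r (ltW ap); apply: rnorm_ge0.
Qed.

(** By [rnorm_le_phi], preimages of approximations of T form a Cauchy sequence of [A]: the range of
    [phi] is closed. *)
Let phi_onto (T : H -> H) : approx_finite_rank (f := @hdot R H) T ->
  exists a, phi a = T.
Proof.
move=> aT.
have /choice[b bP] (m : nat) : exists b, forall v,
    rnorm (T v - phi b v) <= m.+1%:R^-1 * rnorm v.
  have [|ps psP] := aT m.+1%:R^-1; first by rewrite invr_gt0.
  by have [b bP] := phi_finite_rank ps; exists b => v; rewrite bP.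
have [|a aP] := cauchy_rate (u := b) (c := 2).
  move=> m n mn; apply: rnorm_le_phi => [|v]; first by rewrite divr_gt0.
  rewrite phiB; apply: le_trans (rnorm_triB _ (T v) _) _.
  rewrite [rnorm (phi _ _ - _)]rnormB mulrAC mulr2n mulrDl mul1r mulrDl.
  apply: lerD; first by rewrite mulrC; apply: bP.
  apply: le_trans (bP _ _) _; rewrite mulrC ler_wpM2l ?rnorm_ge0 //.
  by rewrite lef_pV2 ?posrE // ler_nat.
exists a; apply/funext => v; apply/eqP; rewrite -subr_eq0; apply/eqP/rnorm_le0.
apply: (@le_add_divS _ _ _ (3 * rnorm v)) => m; rewrite add0r.
apply: le_trans (rnorm_triB _ (phi (b m) v) _) _.
rewrite -phiB [rnorm (_ - T v)]rnormB.
have := bP m v; have := phi_le (a - b m) v.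
have := ler_wpM2r (rnorm_ge0 v) (aP m); rewrite [rnorm (b m - a)]rnormB.
by rewrite mulrAC; move: (m.+1%:R^-1) => k; nra.
Qed.

Lemma row_star_isomorphic : star_isomorphic_K A H.
Proof.
exists phi; split.
- move=> a b ab; apply: (can_inj cstarK); apply: (mact_faithful ipf Xfull) => x.
  by apply: (can_inj VW); rewrite -[x]VW; apply: (congr1 (fun g => g (W x)) ab).
- apply/seteqP; split=> [_ [a _ <-]|T cT].
    by apply/compact_opsP; [exact: phi_linear|exact: phi_approx].
  have [lT _] := cT; move/(compact_opsP lT): cT => /phi_onto[a <-].
  by exists a.
- exact: phiL.
- by move=> a b v; rewrite /phi cstarM mactA VW.
- move=> a v w; rewrite /phi cstarK -{2}(WV v) -{1}(WV w) !W_dot.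
  by rewrite (ip_mact ipf).
Qed.

(** Linear in x, as the antilinearity of W and that of [hdot] in its second argument cancel. *)
Let rowop x : H -> R[i]^o := fun v => hdot v (W x).

Let rowop_range : range rowop = bounded_ops H R[i]^o.
Proof.
apply/seteqP; split=> [_ [x _ <-]|T [lT cT]].
  have lx : linear (rowop x) by move=> c u v; rewrite /rowop (ip_linear ipH).
  split=> //; apply/(linear_boundedP lx).
  exists (rnorm x + 1) => [|v]; first by rewrite ltr_wpDl ?rnorm_ge0.
  rewrite rnorm_scalar; apply: le_trans (cauchy_schwarz ipH _ _) _.
  by rewrite Wnorm mulrC ler_wpM2r ?rnorm_ge0 // lerDl.
have [M _ TM] := (linear_boundedP lT).1 cT.
have [|w wP] := riesz ipH (g := T) (M := M) lT.
  by move=> v; rewrite -rnorm_scalar.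
by exists (V w) => //; apply/funext => v; rewrite /rowop WV wP.
Qed.

Let mip_sq_dot y u : complex.Re (f (mact u (mip y y)) u) = normc (f u y) ^+ 2.
Proof. by rewrite mact_mip (ipZl ipf) -(ip_conj ipf u y) mulcJ. Qed.

(** The hypothesis bounds the quadratic form (uN|u) of N, the sum of the <z_i,z_i>. For y = xN,
    |y|^2 is the sum of the (x|z_i)(z_i|y), and the mean inequality with weights |y| and |x| turns
    two quadratic bounds into |y| <= r^2 |x|. *)
Lemma rnorm_sum_mip_le n (z : 'I_n -> X) (r : R) : 0 <= r ->
  (forall u, \sum_i normc (f u (z i)) ^+ 2 <= r ^+ 2 * rnorm u ^+ 2) ->
  rnorm (\sum_i mip (z i) (z i)) <= r ^+ 2.
Proof.
move=> r0 zr; apply/ler_addgt0Pr => d d0.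
apply: (rnorm_le_right_regular ipf Xfull) => [|x].
  by rewrite ltr_wpDl // sqr_ge0.
set y := mact x _; apply: (@le_trans _ _ (r ^+ 2 * rnorm x)); last first.
  by rewrite ler_wpM2r ?rnorm_ge0 // lerDl ltW.
have [y0|y0] := leP (rnorm y) 0.
  by apply: le_trans y0 _; rewrite mulr_ge0 ?sqr_ge0 ?rnorm_ge0.
have [x0|x0] := leP (rnorm x) 0.
  by move: y0; rewrite /y (rnorm_le0 x0) mact0l rnorm0 ltxx.
have yy : rnorm y ^+ 2 <= \sum_i normc (f x (z i)) * normc (f y (z i)).
  rewrite (rnorm_sqE ipf) {1}/y mact_sumr (ip_suml ipf).
  apply: le_trans (Re_le_normc _) _; elim/big_rec2: _ => [|i p q _ qp].
    by rewrite normc0.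
  apply: le_trans (le_normcD _ _) _; apply: lerD => //.
  by rewrite mact_mip (ipZl ipf) normcM -(ip_conj ipf y) normc_conj.
have am : 2 * (rnorm x * rnorm y) * \sum_i normc (f x (z i)) * normc (f y (z i))
    <= 2 * r ^+ 2 * (rnorm x * rnorm y) ^+ 2.
  have : 2 * (rnorm x * rnorm y) * \sum_i normc (f x (z i)) * normc (f y (z i))
    <= rnorm y ^+ 2 * (\sum_i normc (f x (z i)) ^+ 2) +
       rnorm x ^+ 2 * (\sum_i normc (f y (z i)) ^+ 2).
    rewrite !mulr_sumr -big_split /=; apply: ler_sum => i _.
    have := sqr_ge0 (rnorm y * normc (f x (z i)) - rnorm x * normc (f y (z i))).
    by nra.
  have := ler_wpM2l (sqr_ge0 (rnorm y)) (zr x).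
  have := ler_wpM2l (sqr_ge0 (rnorm x)) (zr y).
  by rewrite exprMn; nra.
have xy0 := mulr_gt0 x0 y0.
have : rnorm y ^+ 2 <= r ^+ 2 * (rnorm x * rnorm y).
  apply: le_trans yy _; rewrite -(ler_pM2l xy0).
  by move: am; rewrite [_ ^+ 2 in X in _ <= X]expr2; nra.
by rewrite expr2 mulrA ler_pM2r.
Qed.

Let row_value n (x : 'M[X]_n) (v : 'I_n -> H) i :
  mxop (map_mx rowop x) v i = \sum_j f (x i j) (V (v j)).
Proof. by apply: eq_bigr => j _; rewrite mxE /rowop -{1}(WV (v j)) W_dot. Qed.

(** For a unit vector e, x<V v_j,e> = (x|V v_j)e: the vectors (0, <V v_j,e>) copy v inside the line
    of e with all norms preserved. *)
Let row_le_module n (x : 'M[X]_n) (v : 'I_n -> H) : l2norm v <= 1 ->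
  exists2 w : 'I_n -> X * A, xa_norm w <= 1 &
    Num.sqrt (rnorm (\sum_i mip (\sum_j mact (x i j) (w j).2)
                                (\sum_j mact (x i j) (w j).2))) =
    l2norm (mxop (map_mx rowop x) v).
Proof.
move=> v1; have [X0|/existsNP[x0 /eqP xn0]] := pselect (forall x : X, x = 0).
  exists (fun=> (0, 0)).
    rewrite /xa_norm big1 ?rnorm0 ?sqrtr0 // => i _ /=.
    by rewrite mip0r cmul0r addr0.
  rewrite /l2norm !big1 ?rnorm0 // => i _.
    by rewrite row_value big1 ?rnorm0 ?expr0n // => j _; rewrite (X0 (x i j)) (ip0l ipf).
  by rewrite (X0 (\sum_j _)) mip0r.
have nx0 : 0 < rnorm x0.
  by rewrite lt_def rnorm_ge0 andbT; apply: contra_neq xn0 => /rnorm0_eq0.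
have [e e1] : exists e : X, rnorm e = 1.
  exists ((rnorm x0)^-1%:C *: x0).
  by rewrite rnormZr gtr0_norm ?invr_gt0 // mulVf // gt_eqF.
have sumE (r : 'I_n -> R) : (forall i, 0 <= r i) ->
    rnorm (\sum_i (r i)%:C *: mip e e) = \sum_i r i.
  move=> r0; rewrite -scaler_suml -rmorph_sum /= rnormZr rnorm_mip e1 expr1n mulr1.
  by rewrite ger0_norm // sumr_ge0.
exists (fun j => (0, mip (V (v j)) e)).
  congr (_ <= 1): v1; rewrite /xa_norm /l2norm -sumE => [|i]; last exact: sqr_ge0.
  congr (Num.sqrt (rnorm _)); apply: eq_bigr => i _ /=.
  rewrite mip0r add0r mip_star -mipMr mact_mip mipZr (ip_norm ipf).
  by rewrite Vnorm.
rewrite /l2norm -sumE => [|i]; last exact: sqr_ge0.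
congr (Num.sqrt (rnorm _)); apply: eq_bigr => i _ /=.
have -> : \sum_j mact (x i j) (mip (V (v j)) e) =
          mxop (map_mx rowop x) v i *: e.
  by rewrite row_value scaler_suml; apply: eq_bigr => j _; rewrite mact_mip.
by rewrite mipZl mipZr scalerA mulrC mulcJ rnorm_scalar.
Qed.

(** The A-components of w are arbitrary, so the output is tested against each u. There w_j moves
    over as an adjoint, leaving the rows x applied to the vectors u.w_j^*, whose squared norms add
    up to at most (uN|u) <= |u|^2. *)
Let row_ge_module n (x : 'M[X]_n) (r : R) (w : 'I_n -> X * A) : 0 <= r ->
  (forall v : 'I_n -> H, l2norm v <= 1 -> l2norm (mxop (map_mx rowop x) v) <= r) ->
  xa_norm w <= 1 ->
  Num.sqrt (rnorm (\sum_i mip (\sum_j mact (x i j) (w j).2)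
                              (\sum_j mact (x i j) (w j).2))) <= r.
Proof.
move=> r0 vr w1.
have hom (y : 'I_n -> X) : \sum_i normc (\sum_j f (x i j) (y j)) ^+ 2 <=
    r ^+ 2 * \sum_j rnorm (y j) ^+ 2.
  set s := \sum_j rnorm _ ^+ 2.
  have s0 : 0 <= s by apply: sumr_ge0 => j _; apply: sqr_ge0.
  have [s_le0|s_gt0] := leP s 0.
    have y0 j : y j = 0.
      apply/rnorm0_eq0/eqP; rewrite -sqrf_eq0.
      have sj : rnorm (y j) ^+ 2 <= s.
        by rewrite /s (bigD1 j) //= lerDl sumr_ge0 // => k _; apply: sqr_ge0.
      by rewrite eq_le sqr_ge0 andbT (le_trans sj).
    rewrite big1 ?mulr_ge0 ?sqr_ge0 // => i _.
    by rewrite big1 ?normc0 ?expr0n // => j _; rewrite y0 (ip0r ipf).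
  pose t := (Num.sqrt s)^-1; have t0 : 0 < t by rewrite invr_gt0 sqrtr_gt0.
  have ts : t ^+ 2 * s = 1 by rewrite exprVn sqr_sqrtr // mulVf // gt_eqF.
  have := vr (fun j => W (t%:C *: y j)).
  have -> : l2norm (fun j => W (t%:C *: y j)) = 1.
    rewrite /l2norm -[RHS]sqrtr1 -ts /s mulr_sumr; congr Num.sqrt.
    by apply: eq_bigr => j _; rewrite Wnorm rnormZr gtr0_norm // exprMn.
  move=> /(_ (lexx _)); rewrite /l2norm.
  rewrite -ler_sqr ?nnegrE ?sqrtr_ge0 // sqr_sqrtr => [|]; last first.
    by apply: sumr_ge0 => i _; apply: sqr_ge0.
  have -> : \sum_i rnorm (mxop (map_mx rowop x) (fun j => W (t%:C *: y j)) i) ^+ 2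
       = t ^+ 2 * \sum_i normc (\sum_j f (x i j) (y j)) ^+ 2.
    rewrite mulr_sumr; apply: eq_bigr => i _; rewrite rnorm_scalar row_value.
    have -> : \sum_j f (x i j) (V (W (t%:C *: y j))) = t%:C * \sum_j f (x i j) (y j).
      by rewrite mulr_sumr; apply: eq_bigr => j _; rewrite VW (ipZrR ipf).
    by rewrite normcM normcR gtr0_norm // exprMn.
  by move=> h; have := ler_wpM2r s0 h; rewrite mulrAC ts mul1r.
set N := \sum_i (mip (w i).1 (w i).1 + cmul (cstar (w i).2) (w i).2).
have N1 : rnorm N <= 1.
  by rewrite -[leLHS]sqr_sqrtr ?rnorm_ge0 // exprn_ile1 ?sqrtr_ge0.
rewrite -ler_sqr ?nnegrE ?sqrtr_ge0 // sqr_sqrtr ?rnorm_ge0 //.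
apply: rnorm_sum_mip_le => // u.
have -> : \sum_i normc (f u (\sum_j mact (x i j) (w j).2)) ^+ 2 =
    \sum_i normc (\sum_j f (x i j) (mact u (cstar (w j).2))) ^+ 2.
  apply: eq_bigr => i _; rewrite -(ip_conj ipf) normc_conj (ip_suml ipf).
  by congr (normc _ ^+ 2); apply: eq_bigr => j _; rewrite (ip_mact ipf).
apply: le_trans (hom _) _; rewrite ler_wpM2l ?sqr_ge0 //.
apply: (@le_trans _ _ (complex.Re (f (mact u N) u))); last first.
  apply: le_trans (Re_cauchy_schwarz ipf _ _) _; rewrite expr2.
  rewrite ler_wpM2r ?rnorm_ge0 //; apply: le_trans (rnorm_mact _ _) _.
  by rewrite ler_piMr ?rnorm_ge0.
rewrite /N mact_sumr (ip_suml ipf).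
elim/big_rec2: _ => [//|j p q _ pq]; rewrite ReD lerD //.
rewrite mactDr (ipDl ipf) ReD mip_sq_dot mactA (ip_mact ipf) -(rnorm_sqE ipf).
by rewrite lerDr sqr_ge0.
Qed.

Lemma row_cisometric : cisometric_row X H.
Proof.
exists rowop; split.
- by move=> c x y v; rewrite /rowop W_antilinear (ipDr ipH) (ipZr ipH) conjCK.
- exact: rowop_range.
move=> n x; rewrite mod_mxnormE; apply/le_anti/andP; split.
  apply: ub_ereal_sup => _ [v /= /(row_le_module x)[w w1 <-] <-].
  by apply: ereal_sup_ubound; exists w.
have opsP (v : 'I_n -> H) : l2norm v <= 1 ->
    ((l2norm (mxop (map_mx rowop x) v))%:E <= ops_mxnorm (map_mx rowop x))%E.
  by move=> v1; apply: ereal_sup_ubound; exists v.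
apply: ub_ereal_sup => _ [w /= w1 <-].
(* The zero vector shows that the supremum is not -oo and that it is nonnegative when finite. *)
have l0 : @l2norm R H n (fun=> 0) <= 1.
  by rewrite /l2norm big1 ?sqrtr0 // => i _; rewrite rnorm0 expr0n.
have := opsP _ l0.
case: (ops_mxnorm _) opsP => [r|_ _|_].
- move=> opsP; rewrite lee_fin => /(le_trans (sqrtr_ge0 _)) r0.
  by rewrite lee_fin; apply: row_ge_module => // v /opsP; rewrite lee_fin.
- by rewrite leey.
- by rewrite leNgt ltNyr.
Qed.

End Row.
Theorem corollary3p6 (R : realType) (H : hilbertType R) (A : cstarAlgType R)
    (X : hilbertModType A) (Xfull : full_module X) (XH : isometric X H) :
  (star_isomorphic_C A /\ cisometric_col X H) \/
  (star_isomorphic_K A H /\ cisometric_row X H).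
Proof.
have ipH := hdot_inner_product H.
have [U [Uiso Usurj]] := XH.
have Unorm x : rnorm (U x) = rnorm x by rewrite /rnorm Uiso.
have ipX : inner_product (fun x y : X => hdot (U x) (U y)).
  split=> [c x y z|x y|x]; first by rewrite linearP (ip_linear ipH).
    exact: (ip_conj ipH).
  by rewrite (ip_norm ipH) Unorm.
have [mact_mip|[e [e1 Re mipE]]] := row_or_column ipX; [right|left]; last first.
  split; first exact: (column_star_isomorphic Xfull Uiso e1 Re mipE).
  exact: (column_cisometric Xfull Uiso Usurj e1 Re mipE).
have [J [Jlin JK Jdot]] := antiunitary_involution ipH.
(* V is the inverse of the antiunitary J U, since J is its own inverse. *)
have /choice[V UV] (h : H) : exists x, U x = J h by apply: Usurj.
have Uinj : injective U.
  move=> x y /eqP; rewrite -subr_eq0 -linearB => /eqP Uxy.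
  by apply/eqP; rewrite -subr_eq0; apply/eqP/rnorm0_eq0; rewrite -Unorm Uxy rnorm0.
have Wlin c x y : J (U (c *: x + y)) = c^* *: J (U x) + J (U y).
  by rewrite linearP Jlin.
have Wdot x y : hdot (J (U x)) (J (U y)) = hdot (U y) (U x) by apply: Jdot.
have WV : cancel V (J \o U) by move=> h /=; rewrite UV JK.
have VW : cancel (J \o U) V by move=> x; apply: Uinj; rewrite UV /= JK.
split; first exact: (row_star_isomorphic ipX Xfull mact_mip Wlin Wdot WV VW).
exact: (row_cisometric ipX Xfull mact_mip Wlin Wdot WV VW).
Qed.
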